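(* Let $b,n\in\mathbb C$, and consider the recurrence relations $$((k+b)(k+b+n-1)+\lambda)a_k-\mu(k+b+n-1)a_{k-1}+\mu(k+b+1)a_{k+1}=0.\qquad ( * )$$ (i) Let $k_0\in\mathbb Z$ be such that $$k+b+n-1\neq0 \text{ and } k+b+1\neq0\ \text{ for every integer } k>k_0.$$ Then for every $\lambda,\mu\in\mathbb C$, $\mu\neq0$, there exists a unique (up to a constant factor) nonzero one-sided series $\sum_{k\geq k_0}a_kz^k$ converging on some punctured disk centered at $0$ whose coefficients satisfy $( * )$ for all $k>k_0$. (ii) Let $k_0\in\mathbb Z$ be such that $$k+b+n-1\neq0 \text{ and } k+b+1\neq0\ \text{ for every integer } k<k_0.$$ Then for every $\lambda,\mu\in\mathbb C$, $\mu\ne0$, there exists a unique (up to a multiplicative constant) nonzero one-sided series $\sum_{k\leq k_0}a_kz^k$ whose coefficients satisfy $( * )$ for all $k<k_0$ and which converges outside some disk centered at $0$. Both series converge on the whole punctured complex line $\mathbb C^*=\mathbb C\setminus\{0\}$. They can be normalized to depend holomorphically on those parameters $(n,\lambda,\mu,b)$ (with $\mu\neq 0$) for which, for the given number $k_0$, one has $k+b+n-1\neq0$ and $k+b+1\neq0$ for every integer $k>k_0$ in the case of the series $\sum_{k\geq k_0}a_kz^k$ (respectively, for every integer $k<k_0$ in the case of the series $\sum_{k\leq k_0}a_kz^k$). *)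

(* Defs.v *)
From Stdlib Require Export Reals ZArith.
From Coquelicot Require Export Coquelicot.
Open Scope C_scope.

Definition ZtoC (k : Z) : C := RtoC (IZR k).

(* Integer powers; only used at nonzero arguments, since / 0 is a junk value. *)
Definition Cpowz (z : C) (k : Z) : C :=
  match k with
  | Z0 => 1
  | Zpos p => z ^ Pos.to_nat p
  | Zneg p => / (z ^ Pos.to_nat p)
  end.

Definition recurrence (n lambda mu b : C) (a : Z -> C) (k : Z) : Prop :=
  ((ZtoC k + b) * (ZtoC k + b + n - 1) + lambda) * a k
  - mu * (ZtoC k + b + n - 1) * a (k - 1)%Z
  + mu * (ZtoC k + b + 1) * a (k + 1)%Z = 0.

Definition nonresonant (n b : C) (k : Z) : Prop :=
  ZtoC k + b + n - 1 <> 0 /\ ZtoC k + b + 1 <> 0.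

Definition nonresonant_above (k0 : Z) (n b : C) : Prop :=
  forall k : Z, (k0 < k)%Z -> nonresonant n b k.

Definition nonresonant_below (k0 : Z) (n b : C) : Prop :=
  forall k : Z, (k < k0)%Z -> nonresonant n b k.

(* A one-sided series is represented by a : Z -> C, of which only the values
   at k >= k0 (resp. k <= k0) are relevant: the others never occur below. *)

Definition upper_sum (k0 : Z) (a : Z -> C) (z s : C) : Prop :=
  is_series (V := C_NormedModule)
    (fun j : nat => let k := (k0 + Z.of_nat j)%Z in a k * Cpowz z k) s.

Definition lower_sum (k0 : Z) (a : Z -> C) (z s : C) : Prop :=
  is_series (V := C_NormedModule)
    (fun j : nat => let k := (k0 - Z.of_nat j)%Z in a k * Cpowz z k) s.

Definition upper_converges (k0 : Z) (a : Z -> C) (z : C) : Prop :=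
  exists s : C, upper_sum k0 a z s.

Definition lower_converges (k0 : Z) (a : Z -> C) (z : C) : Prop :=
  exists s : C, lower_sum k0 a z s.

Definition upper_nonzero (k0 : Z) (a : Z -> C) : Prop :=
  exists k : Z, (k0 <= k)%Z /\ a k <> 0.

Definition lower_nonzero (k0 : Z) (a : Z -> C) : Prop :=
  exists k : Z, (k <= k0)%Z /\ a k <> 0.

Definition upper_solution (k0 : Z) (n lambda mu b : C) (a : Z -> C) : Prop :=
  upper_nonzero k0 a /\
  (forall k : Z, (k0 < k)%Z -> recurrence n lambda mu b a k) /\
  (exists r : R, (0 < r)%R /\
     forall z : C, (0 < Cmod z < r)%R -> upper_converges k0 a z).

Definition lower_solution (k0 : Z) (n lambda mu b : C) (a : Z -> C) : Prop :=
  lower_nonzero k0 a /\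
  (forall k : Z, (k < k0)%Z -> recurrence n lambda mu b a k) /\
  (exists r : R, (0 < r)%R /\
     forall z : C, (r < Cmod z)%R -> lower_converges k0 a z).

(* C^4 (parameters (n, lambda, mu, b)) and C x C^4, as complex normed modules. *)
Definition C2 := prod_NormedModule C_AbsRing C_NormedModule C_NormedModule.
Definition C3 := prod_NormedModule C_AbsRing C2 C_NormedModule.
Definition C4 := prod_NormedModule C_AbsRing C3 C_NormedModule.
Definition C1_4 := prod_NormedModule C_AbsRing C_NormedModule C4.

Definition upper_domain (k0 : Z) (p : C4) : Prop :=
  let '(n, lambda, mu, b) := (p : C * C * C * C) in mu <> 0 /\ nonresonant_above k0 n b.

Definition lower_domain (k0 : Z) (p : C4) : Prop :=
  let '(n, lambda, mu, b) := (p : C * C * C * C) in mu <> 0 /\ nonresonant_below k0 n b.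

(* Complex Frechet differentiability at every point of D (D is meant to be
   open), i.e. holomorphy in all the variables jointly. *)
Definition holomorphic_on {U : NormedModule C_AbsRing}
    (D : U -> Prop) (f : U -> C) : Prop :=
  forall p : U, D p ->
    ex_filterdiff (K := C_AbsRing) (U := U) (V := C_NormedModule)
      f (locally p).

(* Main.v *)
Require Import Defs.
From Stdlib Require Import Lra Lia IndefiniteDescription.

(* As [k] grows, one solution satisfies [a_k ~ (mu / k) a_(k-1)] and the others
   [a_(k+1) ~ - (k / mu) a_k]; the situation as [k] decreases is symmetric.  With
   [j = |k - k0|], factoring out an explicit product of size [C^j / j!], the small
   solution becomes the solution tending to 1 of
   [x_j = (1 + alpha_j) x_(j+1) + beta_j x_(j+2)] with [alpha_j], [beta_j] = O(1/j^2);
   it is a series of iterates converging locally uniformly in the parameters, which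
   gives holomorphy, and the factor [1/j!] gives convergence for every [z <> 0].
   Uniqueness: the Casoratian of two solutions is multiplied at each step by a
   quotient bounded away from 0, so it decays at most geometrically, while for a
   second convergent solution it would decay faster than every geometric sequence;
   hence it vanishes. *)

(** The coefficient at [k0] of the small solution may vanish for some parameters, so it cannot serve
    as a normalization; prescribing the limit 1 of the gauged sequence fixes a nonzero solution on
    the whole domain at once. The gauge has to match the ratio of consecutive coefficients up to a
    relative error O(1/j^2): an error of order 1/j would leave the series of iterates without a
    summable majorant. The two directions differ only in the gauge that achieves this, so everything
    else is proved once for an abstract [scheme]. Each estimate bounds a function together with its
    first-order expansion in the parameters, on one ball that is valid for all indices. This yields
    differentiability of the sums directly, and for constant functions it yields existence and
    convergence at fixed parameters. The variable z is treated as one more parameter, so joint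
    holomorphy of the sum in z and the parameters comes from the same estimates. *)

(** * Sums of absolutely convergent complex series *)

(** Built from the total function [Series], so that a sum depending on parameters is a function on
    the whole parameter space, with default values where the series diverges. *)
Definition Csum (f : nat -> C) : C :=
  (Series (fun n => Re (f n)), Series (fun n => Im (f n))).

Lemma Cmod_sqr (z : C) : (Cmod z * Cmod z = Re z * Re z + Im z * Im z)%R.
Proof.
unfold Cmod. rewrite sqrt_sqrt.
- unfold Re, Im. ring.
- generalize (pow2_ge_0 (fst z)) (pow2_ge_0 (snd z)). lra.
Qed.

Lemma im_le_Cmod (z : C) : (Rabs (Im z) <= Cmod z)%R.
Proof. eapply Rle_trans; [apply Rmax_r | apply Rmax_Cmod]. Qed.

Lemma ex_series_le_R (f g : nat -> R) :
  (forall n, (Rabs (f n) <= g n)%R) -> ex_series g -> ex_series f.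
Proof. intros H Hg. apply (ex_series_le (V := R_CompleteNormedModule) f g); auto. Qed.

Lemma ex_series_scal_R (c : R) (f : nat -> R) :
  ex_series f -> ex_series (fun n => (c * f n)%R).
Proof. exact (ex_series_scal (V := R_NormedModule) c f). Qed.

Lemma is_series_pair (f : nat -> C) (s : C) :
  is_series (fun n => Re (f n)) (Re s) -> is_series (fun n => Im (f n)) (Im s) ->
  is_series (V := C_NormedModule) f s.
Proof.
intros H1 H2. unfold is_series.
apply filterlim_locally. intros eps.
assert (E : forall n, sum_n (G := C_NormedModule) f n
    = (sum_n (fun n => Re (f n)) n, sum_n (fun n => Im (f n)) n)).
{ induction n as [|n IH].
  - rewrite !sum_O. destruct (f 0%nat); reflexivity.
  - rewrite !sum_Sn, IH. destruct (f (S n)); reflexivity. }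
generalize (filter_and _ _ (proj1 (filterlim_locally _ _) H1 eps)
  (proj1 (filterlim_locally _ _) H2 eps)).
apply filter_imp. intros n [B1 B2]. rewrite E. split; assumption.
Qed.

Section AbsoluteSummability.
Variable f : nat -> C.
Hypothesis Hf : ex_series (fun n => Cmod (f n)).

Lemma ex_series_Re : ex_series (fun n => Re (f n)).
Proof. eapply ex_series_le_R; [|exact Hf]. intro; apply re_le_Cmod. Qed.

Lemma ex_series_Im : ex_series (fun n => Im (f n)).
Proof. eapply ex_series_le_R; [|exact Hf]. intro; apply im_le_Cmod. Qed.

Lemma Csum_correct : is_series (V := C_NormedModule) f (Csum f).
Proof.
apply is_series_pair; apply Series_correct; [apply ex_series_Re | apply ex_series_Im].
Qed.

Lemma Csum_scal (c : C) : Csum (fun n => c * f n) = c * Csum f.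
Proof.
generalize ex_series_Re ex_series_Im; intros H1 H2.
unfold Csum, Cmult; simpl. f_equal.
- unfold Rminus. rewrite <- !Series_scal_l, <- Series_opp, <- Series_plus.
  + apply Series_ext; intro; reflexivity.
  + now apply ex_series_scal_R.
  + apply (ex_series_opp (V := R_NormedModule)). now apply ex_series_scal_R.
- rewrite <- !Series_scal_l, <- Series_plus.
  + apply Series_ext; intro; reflexivity.
  + now apply ex_series_scal_R.
  + now apply ex_series_scal_R.
Qed.

Lemma Csum_incr_1 : Csum f = f 0%nat + Csum (fun n => f (S n)).
Proof.
unfold Csum. rewrite (Series_incr_1 (fun n => Re (f n))) by apply ex_series_Re.
rewrite (Series_incr_1 (fun n => Im (f n))) by apply ex_series_Im. reflexivity.
Qed.

(* Pairing the sum [s] with its own direction reduces this to a real series. *)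
Lemma Csum_norm : (Cmod (Csum f) <= Series (fun n => Cmod (f n)))%R.
Proof.
set (s := Csum f).
destruct (Req_dec (Cmod s) 0) as [E|E].
{ rewrite E. rewrite <- (Rmult_0_l (Series (fun n => Cmod (f n)))), <- Series_scal_l.
  apply Series_le; [|exact Hf]. intro n. generalize (Cmod_ge_0 (f n)); lra. }
generalize (Cmod_ge_0 s); intro Hs.
apply Rmult_le_reg_l with (Cmod s); [lra|].
rewrite Cmod_sqr.
replace (Re s * Re s + Im s * Im s)%R
  with (Series (fun n => Re s * Re (f n) + Im s * Im (f n)))%R.
- rewrite <- Series_scal_l.
  eapply Rle_trans; [apply Rle_abs|].
  assert (B : forall n, (Rabs (Re s * Re (f n) + Im s * Im (f n)) <= Cmod s * Cmod (f n))%R).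
  { intro n.
    replace (Re s * Re (f n) + Im s * Im (f n))%R with (Re (Cconj s * f n)).
    - eapply Rle_trans; [apply re_le_Cmod|]. rewrite Cmod_mult, Cmod_conj. lra.
    - unfold Re, Im, Cconj, Cmult; simpl. ring. }
  assert (X : ex_series (fun n => (Cmod s * Cmod (f n))%R)) by now apply ex_series_scal_R.
  eapply Rle_trans.
  + apply Series_Rabs. eapply ex_series_le_R; [|exact X].
    intro n; rewrite Rabs_Rabsolu; apply B.
  + apply Series_le; [|exact X]. intro n; split; [apply Rabs_pos | apply B].
- rewrite Series_plus, !Series_scal_l; [reflexivity | |].
  + apply ex_series_scal_R, ex_series_Re.
  + apply ex_series_scal_R, ex_series_Im.
Qed.
End AbsoluteSummability.

Lemma Csum_ext (f g : nat -> C) : (forall n, f n = g n) -> Csum f = Csum g.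
Proof. intro H. unfold Csum. f_equal; apply Series_ext; intro; now rewrite H. Qed.

Lemma Csum_plus (f g : nat -> C) :
  ex_series (fun n => Cmod (f n)) -> ex_series (fun n => Cmod (g n)) ->
  Csum (fun n => f n + g n) = Csum f + Csum g.
Proof.
intros Hf Hg. unfold Csum, Cplus; simpl. f_equal; apply Series_plus;
  (apply ex_series_Re || apply ex_series_Im); assumption.
Qed.

Lemma ex_series_Cmod_le (f : nat -> C) (g : nat -> R) :
  (forall n, (Cmod (f n) <= g n)%R) -> ex_series g -> ex_series (fun n => Cmod (f n)).
Proof.
intros H Hg. eapply ex_series_le_R; [|exact Hg].
intro n. rewrite Rabs_pos_eq; [apply H | apply Cmod_ge_0].
Qed.

Lemma Csum_norm_le (f : nat -> C) (g : nat -> R) :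
  (forall n, (Cmod (f n) <= g n)%R) -> ex_series g -> (Cmod (Csum f) <= Series g)%R.
Proof.
intros H Hg. eapply Rle_trans.
- apply Csum_norm. eapply ex_series_Cmod_le; eassumption.
- apply Series_le; [|exact Hg]. intro n; split; [apply Cmod_ge_0 | apply H].
Qed.

Lemma is_series_terms_bounded (f : nat -> C) (s : C) :
  is_series (V := C_NormedModule) f s -> exists M, forall n, (Cmod (f n) <= M)%R.
Proof.
intro H. destruct (filterlim_bounded (V := C_NormedModule) (sum_n f)) as [M HM].
{ exists s. exact H. }
assert (HM' : forall n, (Cmod (sum_n (G := C_NormedModule) f n) <= M)%R) by exact HM.
exists (M + M)%R. intros [|n].
- assert (H0 : (Cmod (f 0%nat) <= M)%R) by (rewrite <- (sum_O (G := C_NormedModule) f); apply HM').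
  generalize (Cmod_ge_0 (f 0%nat)). lra.
- generalize (HM' n) (HM' (S n)). rewrite sum_Sn.
  generalize (sum_n (G := C_NormedModule) f n). intros t H1 H2.
  replace (f (S n)) with (plus t (f (S n)) + - t)
    by (change (plus t (f (S n))) with (Cplus t (f (S n))); ring).
  eapply Rle_trans; [apply Cmod_triangle|]. rewrite Cmod_opp.
  apply Rplus_le_compat; assumption.
Qed.

(** * Quantitative first-order expansions *)

Section Jets.
Context {U : NormedModule C_AbsRing}.

Definition Clinear (L : U -> C) : Prop :=
  (forall x y : U, L (plus x y) = L x + L y) /\
  (forall (k : C) (x : U), L (scal k x) = k * L x).

(* Bounds on the value, the derivative and a quadratic remainder at the single
   point [p].  They pass to sums of series, so that no Cauchy formula is needed
   to differentiate a locally uniform limit of holomorphic functions. *)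
Record jet_with (p : U) (r : R) (f L : U -> C) (m0 m1 m2 : R) : Prop := {
  jet_linear : Clinear L;
  jet_pos1 : (0 <= m1)%R;
  jet_pos2 : (0 <= m2)%R;
  jet_value : (Cmod (f p) <= m0)%R;
  jet_slope : forall h : U, (Cmod (L h) <= m1 * norm h)%R;
  jet_rest : forall h : U, (norm h <= r)%R ->
    (Cmod (f (plus p h) - f p - L h) <= m2 * (norm h * norm h))%R }.

(** Keeping only the total of the three constants makes [M] behave like a Banach algebra norm, so
    that a convergent series of such bounds is a Weierstrass majorant. *)
Definition jet (p : U) (r M : R) (f : U -> C) : Prop :=
  exists (L : U -> C) (m0 m1 m2 : R),
    jet_with p r f L m0 m1 m2 /\ (m0 + m1 + m2 <= M)%R.

Lemma jet_pos0 p r f L m0 m1 m2 : jet_with p r f L m0 m1 m2 -> (0 <= m0)%R.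
Proof. intros []. generalize (Cmod_ge_0 (f p)). lra. Qed.

Lemma jet_pos p r M f : jet p r M f -> (0 <= M)%R.
Proof.
intros (L & m0 & m1 & m2 & J & HM). generalize (jet_pos0 _ _ _ _ _ _ _ J).
destruct J. lra.
Qed.

Lemma jet_weaken p r r' M M' f :
  (r' <= r)%R -> (M <= M')%R -> jet p r M f -> jet p r' M' f.
Proof.
intros Hr HM (L & m0 & m1 & m2 & [] & H). exists L, m0, m1, m2. split; [|lra].
split; auto. intros h Hh. apply jet_rest0. lra.
Qed.

Lemma jet_ext p r M f g : (forall q, f q = g q) -> jet p r M f -> jet p r M g.
Proof.
intros E (L & m0 & m1 & m2 & [] & H). exists L, m0, m1, m2. split; [|exact H].
split; auto; [now rewrite <- E | intros h Hh; rewrite <- !E; auto].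
Qed.

Lemma jet_at p r M f : jet p r M f -> (Cmod (f p) <= M)%R.
Proof.
intros (L & m0 & m1 & m2 & J & HM). destruct J. lra.
Qed.

Lemma jet_const p r c : jet p r (Cmod c) (fun _ => c).
Proof.
exists (fun _ => RtoC 0), (Cmod c), 0%R, 0%R. split; [|lra].
split; try lra.
- split; intros; ring.
- intro h. rewrite Cmod_0. lra.
- intros h _. replace (c - c - 0) with (RtoC 0) by ring. rewrite Cmod_0. lra.
Qed.

Lemma jet_1 p r : jet p r 1 (fun _ => RtoC 1).
Proof. rewrite <- Cmod_1 at 1. apply jet_const. Qed.

Lemma jet_Clinear p r L : Clinear L -> (forall h, (Cmod (L h) <= norm h)%R) ->
  jet p r (Cmod (L p) + 1) L.
Proof.
intros HL Hn. exists L, (Cmod (L p)), 1%R, 0%R. split; [|lra].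
split; try lra; auto.
- intro h. rewrite Rmult_1_l. apply Hn.
- intros h _. rewrite (proj1 HL). replace (L p + L h - L p - L h) with (RtoC 0) by ring.
  rewrite Cmod_0. lra.
Qed.

Lemma jet_plus p r M N f g :
  jet p r M f -> jet p r N g -> jet p r (M + N) (fun q => f q + g q).
Proof.
intros (L & m0 & m1 & m2 & [[La Ls] ? ? ? ? ?] & H)
  (L' & n0 & n1 & n2 & [[La' Ls'] ? ? ? ? ?] & H').
exists (fun h => L h + L' h), (m0 + n0)%R, (m1 + n1)%R, (m2 + n2)%R. split; [|lra].
split; try lra.
- split; intros; [rewrite La, La' | rewrite Ls, Ls']; ring.
- eapply Rle_trans; [apply Cmod_triangle|]. lra.
- intro h. eapply Rle_trans; [apply Cmod_triangle|].
  generalize (jet_slope0 h) (jet_slope1 h). lra.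
- intros h Hh.
  replace (f (plus p h) + g (plus p h) - (f p + g p) - (L h + L' h))
    with ((f (plus p h) - f p - L h) + (g (plus p h) - g p - L' h)) by ring.
  eapply Rle_trans; [apply Cmod_triangle|].
  generalize (jet_rest0 h Hh) (jet_rest1 h Hh). lra.
Qed.

Lemma Rmult_le_compat_pos (a b c d : R) :
  (0 <= a -> 0 <= c -> a <= b -> c <= d -> a * c <= b * d)%R.
Proof. intros; apply Rmult_le_compat; lra. Qed.

(* The coefficients of the product of two first-order Taylor expansions with
   remainder multiply like polynomials, so for [r <= 1] the bound [M] is
   submultiplicative with constant one. *)
Lemma jet_mult p r M N f g : (r <= 1)%R ->
  jet p r M f -> jet p r N g -> jet p r (M * N) (fun q => f q * g q).
Proof.
intros Hr (L & m0 & m1 & m2 & J & H) (L' & n0 & n1 & n2 & J' & H').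
generalize (jet_pos0 _ _ _ _ _ _ _ J) (jet_pos0 _ _ _ _ _ _ _ J'). intros Hm0 Hn0.
destruct J as [[La Ls] Hm1 Hm2 Jv Jl Jr]. destruct J' as [[La' Ls'] Hn1 Hn2 Jv' Jl' Jr'].
exists (fun h => f p * L' h + g p * L h), (m0 * n0)%R, (m0 * n1 + m1 * n0)%R,
  (m0 * n2 + m2 * n0 + m1 * n1 + m1 * n2 + m2 * n1 + m2 * n2)%R.
split.
2:{ apply Rle_trans with ((m0 + m1 + m2) * (n0 + n1 + n2))%R; [lra|].
    apply Rmult_le_compat; lra. }
split.
- split; intros; [rewrite La, La' | rewrite Ls, Ls']; ring.
- generalize (Rmult_le_pos _ _ Hm0 Hn1) (Rmult_le_pos _ _ Hm1 Hn0). lra.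
- generalize (Rmult_le_pos _ _ Hm0 Hn2) (Rmult_le_pos _ _ Hm2 Hn0) (Rmult_le_pos _ _ Hm1 Hn1)
    (Rmult_le_pos _ _ Hm1 Hn2) (Rmult_le_pos _ _ Hm2 Hn1) (Rmult_le_pos _ _ Hm2 Hn2). lra.
- rewrite Cmod_mult. apply Rmult_le_compat_pos; auto using Cmod_ge_0.
- intro h. eapply Rle_trans; [apply Cmod_triangle|]. rewrite !Cmod_mult.
  apply Rle_trans with (m0 * (n1 * norm h) + n0 * (m1 * norm h))%R; [|lra].
  apply Rplus_le_compat; apply Rmult_le_compat_pos; auto using Cmod_ge_0.
- intros h Hh. specialize (Jr h Hh). specialize (Jr' h Hh).
  specialize (Jl h). specialize (Jl' h).
  set (Rf := f (plus p h) - f p - L h) in *. set (Rg := g (plus p h) - g p - L' h) in *.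
  replace (f (plus p h)) with (f p + L h + Rf) by (unfold Rf; ring).
  replace (g (plus p h)) with (g p + L' h + Rg) by (unfold Rg; ring).
  replace ((f p + L h + Rf) * (g p + L' h + Rg) - f p * g p - (f p * L' h + g p * L h))
    with (f p * Rg + Rf * g p + L h * L' h + (L h * Rg + (Rf * L' h + Rf * Rg))) by ring.
  generalize (norm_ge_0 h). set (t := norm h) in *. intro Ht.
  assert (Ht2 : (0 <= t * t)%R) by now apply Rmult_le_pos.
  assert (Ht3 : (t * (t * t) <= t * t)%R).
  { rewrite <- (Rmult_1_l (t * t)) at 2. apply Rmult_le_compat_r; lra. }
  assert (Ht4 : ((t * t) * (t * t) <= t * t)%R).
  { rewrite Rmult_assoc. apply Rle_trans with (t * (t * t))%R; [|exact Ht3].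
    apply Rmult_le_compat_l; lra. }
  assert (B1 : (Cmod (f p * Rg) <= m0 * (n2 * (t * t)))%R)
    by (rewrite Cmod_mult; apply Rmult_le_compat_pos; auto using Cmod_ge_0).
  assert (B2 : (Cmod (Rf * g p) <= (m2 * (t * t)) * n0)%R)
    by (rewrite Cmod_mult; apply Rmult_le_compat_pos; auto using Cmod_ge_0).
  assert (B3 : (Cmod (L h * L' h) <= (m1 * t) * (n1 * t))%R)
    by (rewrite Cmod_mult; apply Rmult_le_compat_pos; auto using Cmod_ge_0).
  assert (B4 : (Cmod (L h * Rg) <= (m1 * t) * (n2 * (t * t)))%R)
    by (rewrite Cmod_mult; apply Rmult_le_compat_pos; auto using Cmod_ge_0).
  assert (B5 : (Cmod (Rf * L' h) <= (m2 * (t * t)) * (n1 * t))%R)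
    by (rewrite Cmod_mult; apply Rmult_le_compat_pos; auto using Cmod_ge_0).
  assert (B6 : (Cmod (Rf * Rg) <= (m2 * (t * t)) * (n2 * (t * t)))%R)
    by (rewrite Cmod_mult; apply Rmult_le_compat_pos; auto using Cmod_ge_0).
  generalize (Rmult_le_compat_l _ _ _ (Rmult_le_pos _ _ Hm1 Hn2) Ht3)
    (Rmult_le_compat_l _ _ _ (Rmult_le_pos _ _ Hm2 Hn1) Ht3)
    (Rmult_le_compat_l _ _ _ (Rmult_le_pos _ _ Hm2 Hn2) Ht4).
  intros T1 T2 T3.
  assert (S : (Cmod (f p * Rg + Rf * g p + L h * L' h + (L h * Rg + (Rf * L' h + Rf * Rg)))
    <= Cmod (f p * Rg) + Cmod (Rf * g p) + Cmod (L h * L' h)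
       + (Cmod (L h * Rg) + (Cmod (Rf * L' h) + Cmod (Rf * Rg))))%R).
  { eapply Rle_trans; [apply Cmod_triangle|]. apply Rplus_le_compat.
    - eapply Rle_trans; [apply Cmod_triangle|]. apply Rplus_le_compat_r, Cmod_triangle.
    - eapply Rle_trans; [apply Cmod_triangle|]. apply Rplus_le_compat_l, Cmod_triangle. }
  lra.
Qed.

Lemma jet_pow p r M f n : (r <= 1)%R -> jet p r M f ->
  jet p r (M ^ n) (fun q => f q ^ n).
Proof.
intros Hr Hf. induction n as [|n IH].
- apply jet_1.
- apply (jet_mult p r M (M ^ n)); assumption.
Qed.

(** The constant [c] is kept apart from [w] so that [K] stays fixed when [c] runs through the
    integers and only [d] grows. The condition on [r] keeps the increment of [w] below [d / 2],
    hence the denominator above [d / 2]; this is the origin of the factor 2 in front of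
    [K ^ 2 / d ^ 3]. *)
Lemma jet_inv (c : C) p r K d w : (0 < d)%R -> (r <= 1)%R -> (2 * (K * r) <= d)%R ->
  (d <= Cmod (c + w p))%R -> jet p r K w ->
  jet p r (/ d + 2 * K / d ^ 2 + 2 * K ^ 2 / d ^ 3) (fun q => / (c + w q)).
Proof.
intros Hd Hr HK Ha (L & m0 & m1 & m2 & J & H).
generalize (jet_pos0 _ _ _ _ _ _ _ J). intros Hm0.
destruct J as [[La Ls] Hm1 Hm2 Jv Jl Jr].
set (a := c + w p) in *.
assert (Ha0 : a <> 0) by (apply Cmod_gt_0; lra).
assert (Hia : (Cmod (/ a) <= / d)%R)
  by (rewrite Cmod_inv by exact Ha0; apply Rinv_le_contravar; lra).
assert (Hid : (0 < / d)%R) by now apply Rinv_0_lt_compat.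
generalize (Cmod_ge_0 (/ a)); intro Hia0.
assert (Hia2 : (Cmod (/ a * / a) <= / d * / d)%R)
  by (rewrite Cmod_mult; apply Rmult_le_compat; assumption).
exists (fun h => - (/ a * / a) * L h), (/ d)%R, (K / d ^ 2)%R, (K / d ^ 2 + 2 * K ^ 2 / d ^ 3)%R.
assert (HK0 : (0 <= K)%R) by lra.
assert (HKd : (0 <= K / d ^ 2)%R).
{ apply Rmult_le_pos; [exact HK0|]. apply Rlt_le, Rinv_0_lt_compat, pow_lt, Hd. }
assert (HKd3 : (0 <= 2 * K ^ 2 / d ^ 3)%R).
{ apply Rmult_le_pos; [apply Rmult_le_pos; [lra | now apply pow_le]|].
  apply Rlt_le, Rinv_0_lt_compat, pow_lt, Hd. }
split; [|unfold Rdiv; lra].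
split.
- split; intros; [rewrite La | rewrite Ls]; ring.
- exact HKd.
- lra.
- exact Hia.
- intro h. rewrite Cmod_mult, Cmod_opp.
  replace (K / d ^ 2 * norm h)%R with ((/ d * / d) * (K * norm h))%R by (field; lra).
  apply Rmult_le_compat_pos; auto using Cmod_ge_0.
  eapply Rle_trans; [apply Jl|]. apply Rmult_le_compat_r; [apply norm_ge_0 | lra].
- intros h Hh. specialize (Jr h Hh). specialize (Jl h).
  generalize (norm_ge_0 h). set (t := norm h) in *. intro Ht.
  set (e := w (plus p h) - w p).
  assert (He : (Cmod e <= K * t)%R).
  { replace e with (L h + (w (plus p h) - w p - L h)) by (unfold e; ring).
    eapply Rle_trans; [apply Cmod_triangle|].
    apply Rle_trans with (m1 * t + m2 * t)%R.
    - apply Rplus_le_compat; [exact Jl|]. eapply Rle_trans; [exact Jr|].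
      apply Rmult_le_compat_l; [exact Hm2|].
      rewrite <- (Rmult_1_l t) at 3. apply Rmult_le_compat_r; lra.
    - rewrite <- Rmult_plus_distr_r. apply Rmult_le_compat_r; lra. }
  assert (HKt : (K * t <= K * r)%R) by (apply Rmult_le_compat_l; lra).
  assert (Hb : (d / 2 <= Cmod (a + e))%R).
  { generalize (Cmod_triangle (a + e) (- e)). replace (a + e + - e) with a by ring.
    rewrite Cmod_opp. lra. }
  assert (Hb0 : a + e <> 0) by (apply Cmod_gt_0; lra).
  fold a. replace (c + w (plus p h)) with (a + e) by (unfold a, e; ring).
  (* From 1/(a+e) - 1/a = - e/a^2 + e^2/(a^2 (a+e)), where [e] is [L h] plus the quadratic remainder
     of [w]. *)
  replace (/ (a + e) - / a - - (/ a * / a) * L h)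
    with (- (/ a * / a) * (w (plus p h) - w p - L h) + (/ a * / a) * (e * e * / (a + e))).
  2:{ fold e. field. split; assumption. }
  eapply Rle_trans; [apply Cmod_triangle|].
  rewrite Rmult_plus_distr_r. apply Rplus_le_compat.
  + rewrite Cmod_mult, Cmod_opp.
    replace (K / d ^ 2 * (t * t))%R with ((/ d * / d) * (K * (t * t)))%R by (field; lra).
    apply Rmult_le_compat_pos; auto using Cmod_ge_0.
    eapply Rle_trans; [exact Jr|].
    apply Rmult_le_compat_r; [now apply Rmult_le_pos | lra].
  + rewrite Cmod_mult, (Cmod_mult (e * e)), (Cmod_mult e e), Cmod_inv by exact Hb0.
    replace (2 * K ^ 2 / d ^ 3 * (t * t))%R
      with ((/ d * / d) * (((K * t) * (K * t)) * / (d / 2)))%R by (field; lra).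
    apply Rmult_le_compat_pos; auto using Cmod_ge_0.
    * apply Rmult_le_pos; [apply Rmult_le_pos; apply Cmod_ge_0|].
      apply Rlt_le, Rinv_0_lt_compat. lra.
    * apply Rmult_le_compat_pos; try (apply Rmult_le_pos; apply Cmod_ge_0).
      -- apply Rlt_le, Rinv_0_lt_compat. lra.
      -- apply Rmult_le_compat_pos; auto using Cmod_ge_0.
      -- apply Rinv_le_contravar; lra.
Qed.

(** For [norm h <= 1] the linear and quadratic terms cost at most [m1] and [m2]. This makes a series
    of jets converge at the neighbours of [p], not only at [p]. *)
Lemma jet_sup p r M f h : (r <= 1)%R -> (norm h <= r)%R -> jet p r M f ->
  (Cmod (f (plus p h)) <= M)%R.
Proof.
intros Hr Hh (L & m0 & m1 & m2 & [_ Hm1 Hm2 Jv Jl Jr] & H).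
specialize (Jr h Hh). specialize (Jl h).
generalize (norm_ge_0 h). set (t := norm h) in *. intro Ht.
replace (f (plus p h)) with (f p + (L h + (f (plus p h) - f p - L h))) by ring.
eapply Rle_trans; [apply Cmod_triangle|].
apply Rle_trans with (m0 + (m1 + m2))%R; [|lra].
apply Rplus_le_compat; [exact Jv|].
eapply Rle_trans; [apply Cmod_triangle|]. apply Rplus_le_compat.
- eapply Rle_trans; [exact Jl|]. rewrite <- (Rmult_1_r m1) at 2.
  apply Rmult_le_compat_l; lra.
- eapply Rle_trans; [exact Jr|]. rewrite <- (Rmult_1_r m2) at 2.
  apply Rmult_le_compat_l; [lra|]. rewrite <- (Rmult_1_l 1). apply Rmult_le_compat; lra.
Qed.

(** The Weierstrass test for jets: values, slopes and remainders are each dominated by [M n], so the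
    derivative of the sum is the sum of the derivatives, and its remainder is the sum of the
    remainders. *)
Lemma jet_Csum p r (M : nat -> R) (f : nat -> U -> C) : (0 <= r <= 1)%R ->
  (forall n, jet p r (M n) (f n)) -> ex_series M ->
  jet p r (Series M) (fun q => Csum (fun n => f n q)).
Proof.
intros Hr Hf HM.
assert (Hsum : forall h, (norm h <= r)%R -> ex_series (fun n => Cmod (f n (plus p h)))).
{ intros h Hh. eapply ex_series_Cmod_le; [|exact HM]. intro n. now apply jet_sup with r. }
assert (Hsum0 : ex_series (fun n => Cmod (f n p))).
{ eapply ex_series_Cmod_le; [|exact HM]. intro n. now apply jet_at with r. }
(* Each [jet] hides its derivative and constants behind an existential; summing them over [n]
   requires choosing them as sequences. *)
destruct (functional_choice (fun n (x : (U -> C) * R * R * R) =>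
  let '(L, m0, m1, m2) := x in
  jet_with p r (f n) L m0 m1 m2 /\ (m0 + m1 + m2 <= M n)%R)) as [X HX].
{ intro n. destruct (Hf n) as (L & m0 & m1 & m2 & J). exists (L, m0, m1, m2). exact J. }
set (L := fun n => fst (fst (fst (X n)))).
set (m0 := fun n => snd (fst (fst (X n)))).
set (m1 := fun n => snd (fst (X n))).
set (m2 := fun n => snd (X n)).
assert (J : forall n, jet_with p r (f n) (L n) (m0 n) (m1 n) (m2 n)).
{ intro n. generalize (HX n). unfold L, m0, m1, m2. destruct (X n) as [[[? ?] ?] ?]. now intros []. }
assert (B : forall n, (m0 n + m1 n + m2 n <= M n)%R).
{ intro n. generalize (HX n). unfold L, m0, m1, m2. destruct (X n) as [[[? ?] ?] ?]. now intros []. }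
assert (P0 : forall n, (0 <= m0 n)%R) by (intro n; exact (jet_pos0 _ _ _ _ _ _ _ (J n))).
assert (P1 : forall n, (0 <= m1 n)%R) by (intro n; exact (jet_pos1 _ _ _ _ _ _ _ (J n))).
assert (P2 : forall n, (0 <= m2 n)%R) by (intro n; exact (jet_pos2 _ _ _ _ _ _ _ (J n))).
assert (S0 : ex_series m0).
{ eapply ex_series_le_R; [|exact HM]. intro n. rewrite Rabs_pos_eq by apply P0.
  generalize (B n) (P1 n) (P2 n). lra. }
assert (S1 : ex_series m1).
{ eapply ex_series_le_R; [|exact HM]. intro n. rewrite Rabs_pos_eq by apply P1.
  generalize (B n) (P0 n) (P2 n). lra. }
assert (S2 : ex_series m2).
{ eapply ex_series_le_R; [|exact HM]. intro n. rewrite Rabs_pos_eq by apply P2.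
  generalize (B n) (P0 n) (P1 n). lra. }
assert (SL : forall h, ex_series (fun n => Cmod (L n h))).
{ intro h. apply ex_series_Cmod_le with (fun n => (norm h * m1 n)%R).
  - intro n. rewrite Rmult_comm. apply (jet_slope _ _ _ _ _ _ _ (J n)).
  - now apply ex_series_scal_R. }
exists (fun h => Csum (fun n => L n h)), (Series m0), (Series m1), (Series m2). split.
2:{ rewrite <- !Series_plus; auto; try now apply (ex_series_plus (V := R_NormedModule)).
    apply Series_le; auto. intro n. generalize (B n) (P0 n) (P1 n) (P2 n). lra. }
assert (pos : forall m, (forall n, (0 <= m n)%R) -> ex_series m -> (0 <= Series m)%R).
{ intros m Hm Em. rewrite <- (Rmult_0_l (Series m)), <- Series_scal_l.
  apply Series_le; auto. intro n. generalize (Hm n). lra. }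
split; auto.
- split.
  + intros x y. rewrite <- Csum_plus; auto. apply Csum_ext. intro n.
    apply (jet_linear _ _ _ _ _ _ _ (J n)).
  + intros k x. rewrite <- Csum_scal; auto. apply Csum_ext. intro n.
    apply (jet_linear _ _ _ _ _ _ _ (J n)).
- apply Csum_norm_le; auto. intro n. apply (jet_value _ _ _ _ _ _ _ (J n)).
- intro h. rewrite Rmult_comm, <- Series_scal_l. apply Csum_norm_le; [|now apply ex_series_scal_R].
  intro n. rewrite Rmult_comm. apply (jet_slope _ _ _ _ _ _ _ (J n)).
- intros h Hh.
  assert (E : Csum (fun n => f n (plus p h)) - Csum (fun n => f n p) - Csum (fun n => L n h)
     = Csum (fun n => f n (plus p h) - f n p - L n h)).
  { assert (D : ex_series (fun n => Cmod (f n (plus p h) - f n p - L n h))).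
    { apply ex_series_Cmod_le with (fun n => ((norm h * norm h) * m2 n)%R).
      - intro n. rewrite (Rmult_comm _ (m2 n)). now apply (jet_rest _ _ _ _ _ _ _ (J n)).
      - now apply ex_series_scal_R. }
    replace (Csum (fun n => f n (plus p h)))
      with (Csum (fun n => f n p) + (Csum (fun n => L n h)
             + Csum (fun n => f n (plus p h) - f n p - L n h))).
    - ring.
    - assert (D' : ex_series (fun n => Cmod (L n h + (f n (plus p h) - f n p - L n h)))).
      { eapply ex_series_Cmod_le; [intro n; apply Cmod_triangle|].
        apply (ex_series_plus (V := R_NormedModule)); auto. }
      rewrite <- Csum_plus by auto. rewrite <- Csum_plus by auto.
      apply Csum_ext. intro n. ring. }
  rewrite E, Rmult_comm, <- Series_scal_l.
  apply Csum_norm_le; [|now apply ex_series_scal_R].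
  intro n. rewrite (Rmult_comm _ (m2 n)). now apply (jet_rest _ _ _ _ _ _ _ (J n)).
Qed.

Lemma jet_differentiable p r M f : (0 < r)%R -> jet p r M f ->
  ex_filterdiff (K := C_AbsRing) (U := U) (V := C_NormedModule) f (locally p).
Proof.
intros Hr (L & m0 & m1 & m2 & [[La Ls] Hm1 Hm2 Jv Jl Jr] & H).
exists L. split.
- split.
  + exact La.
  + exact Ls.
  + exists (m1 + 1)%R. split; [lra|]. intro x. change (Cmod (L x) <= (m1 + 1) * norm x)%R.
    eapply Rle_trans; [apply Jl|]. apply Rmult_le_compat_r; [apply norm_ge_0 | lra].
- intros x Hx. apply is_filter_lim_locally_unique in Hx. subst x.
  intros eps. apply locally_le_locally_norm.
  (* On this ball the remainder [m2 * norm h * norm h] is at most [eps * norm h]; the [+ 1] covers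
     [m2 = 0]. *)
  assert (Hd : (0 < Rmin r (eps / (m2 + 1)))%R).
  { apply Rmin_glb_lt; [exact Hr|]. apply Rdiv_lt_0_compat; [apply cond_pos | lra]. }
  exists (mkposreal _ Hd). intros q Hq. unfold ball_norm in Hq. simpl in Hq.
  set (h := minus q p) in *.
  assert (Hh : (norm h <= r)%R) by (generalize (Rmin_l r (eps / (m2 + 1))); lra).
  assert (He : (norm h <= eps / (m2 + 1))%R) by (generalize (Rmin_r r (eps / (m2 + 1))); lra).
  assert (Hq' : q = plus p h).
  { unfold h, minus. rewrite (plus_comm p), <- plus_assoc.
    exact (eq_sym (eq_trans (f_equal (plus q) (plus_opp_l p)) (plus_zero_r q))). }
  rewrite Hq' at 1.
  eapply Rle_trans; [apply (Jr h Hh)|]. rewrite <- Rmult_assoc.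
  apply Rmult_le_compat_r; [apply norm_ge_0|].
  apply Rle_trans with ((m2 + 1) * norm h)%R.
  + apply Rmult_le_compat_r; [apply norm_ge_0 | lra].
  + apply Rle_trans with ((m2 + 1) * (eps / (m2 + 1)))%R.
    * apply Rmult_le_compat_l; lra.
    * right. field. lra.
Qed.
End Jets.

(** * The minimal solution of a perturbed constant recursion *)

Section Gauge.
Variables (mu : C) (rho alpha beta : nat -> C).

(* [gauged] is the solution with limit 1 of
   [x j = (1 + alpha j) * x (S j) + beta j * x (S (S j))]: iterating the right
   hand side on the constant sequence 1, [correction m] is the [m]-th increment. *)
Fixpoint correction (m j : nat) : C :=
  match m with
  | O => alpha j + beta j
  | S m' => (1 + alpha j) * correction m' (S j) + beta j * correction m' (S (S j))
  end.

Definition gauged (j : nat) : C := 1 + Csum (fun m => correction m j).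

Fixpoint gauge (j : nat) : C :=
  match j with
  | O => 1
  | S i => gauge i * (mu * rho i)
  end.

Definition minimal (j : nat) : C := gauge j * gauged j.
End Gauge.

(** The unit for all bounds of order 1/j^2: it telescopes, so its tail from [j] sums to exactly
    1/(j+1) and its exponentials multiply up in closed form. *)
Definition step (j : nat) : R := (/ (INR j + 1) - / (INR j + 2))%R.

Lemma step_pos j : (0 <= step j)%R.
Proof.
generalize (pos_INR j); intro H. unfold step.
assert (/ (INR j + 2) <= / (INR j + 1))%R by (apply Rinv_le_contravar; lra). lra.
Qed.

Lemma step_eq j : step j = (/ ((INR j + 1) * (INR j + 2)))%R.
Proof. generalize (pos_INR j); intro H. unfold step. field. lra. Qed.

Lemma step_decr j : (step (S j) <= step j)%R.
Proof.
rewrite !step_eq, S_INR. generalize (pos_INR j); intro H.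
apply Rinv_le_contravar; [apply Rmult_lt_0_compat; lra | apply Rmult_le_compat; lra].
Qed.

Lemma is_series_step j : is_series (fun m => step (m + j)) (/ (INR j + 1))%R.
Proof.
assert (E : forall n, (sum_n (fun m => step (m + j)) n = / (INR j + 1) - / (INR n + (INR j + 2)))%R).
{ induction n as [|n IH].
  - rewrite sum_O. unfold step. simpl. rewrite Rplus_0_l. exact eq_refl.
  - rewrite sum_Sn, IH. unfold step.
    change (/ (INR j + 1) - / (INR n + (INR j + 2))
      + (/ (INR (S n + j) + 1) - / (INR (S n + j) + 2))
      = / (INR j + 1) - / (INR (S n) + (INR j + 2)))%R.
    rewrite plus_INR, S_INR.
    replace (INR n + 1 + INR j + 1)%R with (INR n + (INR j + 2))%R by ring.
    replace (INR n + 1 + INR j + 2)%R with (INR n + 1 + (INR j + 2))%R by ring. ring. }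
change (is_lim_seq (sum_n (fun m => step (m + j))) (/ (INR j + 1))%R).
eapply is_lim_seq_ext; [intro n; symmetry; apply E|].
replace (Finite (/ (INR j + 1))%R) with (Finite (/ (INR j + 1) - 0)%R) by (f_equal; ring).
apply is_lim_seq_minus'; [apply is_lim_seq_const|].
apply (is_lim_seq_inv _ p_infty); [|discriminate].
apply is_lim_seq_plus with p_infty (INR j + 2)%R;
  [apply is_lim_seq_INR | apply is_lim_seq_const | reflexivity].
Qed.

Section Tame.
Context {U : NormedModule C_AbsRing}.

(** The decay of [rho] produces the factor 1/j! of the solution, that of [alpha] and [beta] the
    convergence of the iterates. One radius and one [K] serve all indices, which is the local
    uniformity needed for sums. *)
Record tame (p : U) (r K : R) (mu : U -> C) (rho alpha beta : U -> nat -> C) : Prop := {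
  tame_r : (0 < r <= 1)%R;
  tame_mu : jet p r K mu;
  tame_rho : forall i, jet p r (K / (INR i + 1)) (fun q => rho q i);
  tame_alpha : forall i, jet p r (K * step i) (fun q => alpha q i);
  tame_beta : forall i, jet p r (K * step i) (fun q => beta q i) }.

Variables (p : U) (r K : R) (mu : U -> C) (rho alpha beta : U -> nat -> C).
Hypothesis T : tame p r K mu rho alpha beta.

Lemma tame_pos : (0 <= K)%R.
Proof. exact (jet_pos _ _ _ _ (tame_mu _ _ _ _ _ _ _ T)). Qed.

(* [weight j] bounds the tail product of the [1 + 2 K step i], for [i >= j]. *)
Definition weight (j : nat) : R := exp (2 * K * / (INR j + 1)).

Lemma weight_ge_1 j : (1 <= weight j)%R.
Proof.
unfold weight. rewrite <- exp_0 at 1.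
destruct (Rle_lt_or_eq_dec 0 (2 * K * / (INR j + 1))) as [H|H].
- generalize tame_pos (pos_INR j); intros. apply Rmult_le_pos; [lra|].
  apply Rlt_le, Rinv_0_lt_compat. lra.
- left. now apply exp_increasing.
- rewrite <- H. lra.
Qed.

(** The quotient of consecutive weights is exactly exp(2 K step j), because [step] telescopes, and 1
    + x <= exp x. *)
Lemma weight_step j : ((1 + 2 * K * step j) * weight (S j) <= weight j)%R.
Proof.
apply Rle_trans with (exp (2 * K * step j) * weight (S j))%R.
- apply Rmult_le_compat_r; [left; apply exp_pos | apply exp_ineq1_le].
- unfold weight. rewrite <- exp_plus. right. f_equal. unfold step. rewrite S_INR.
  replace (INR j + 1 + 1)%R with (INR j + 2)%R by ring. ring.
Qed.

Lemma weight_decr j : (weight (S j) <= weight j)%R.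
Proof.
eapply Rle_trans; [|apply weight_step].
rewrite <- (Rmult_1_l (weight (S j))) at 1.
apply Rmult_le_compat_r; [left; apply exp_pos|].
generalize (Rmult_le_pos _ _ tame_pos (step_pos j)). lra.
Qed.

Lemma weight_le_0 j : (weight j <= weight 0)%R.
Proof.
induction j as [|j IH]; [lra|]. eapply Rle_trans; [apply weight_decr | exact IH].
Qed.

(** In the induction both [weight] and [step] decrease, so the term at [S (S j)] is dominated by the
    one at [S j]; together they carry the factor [1 + 2 * K * step j], which [weight_step] absorbs.
    Since every unfolding raises [j] by at least one, [m + j] is the argument of [step] that
    survives. *)
Lemma jet_correction m j :
  jet p r (2 * K * weight j * step (m + j)) (fun q => correction (alpha q) (beta q) m j).
Proof.
destruct T as [Hr _ _ Ha Hb].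
generalize tame_pos; intro HK0.
revert j; induction m as [|m IH]; intro j.
- simpl. apply jet_weaken with r (K * step j + K * step j)%R; [lra | | now apply jet_plus].
  generalize (Rmult_le_pos _ _ tame_pos (step_pos j)) (weight_ge_1 j). intros H1 H2.
  replace (2 * K * weight j * step j)%R with ((2 * (K * step j)) * weight j)%R by ring.
  rewrite <- (Rmult_1_r (K * step j + K * step j)).
  apply Rmult_le_compat; lra.
- simpl correction.
  apply jet_weaken with r
    ((1 + K * step j) * (2 * K * weight (S j) * step (m + S j))
     + (K * step j) * (2 * K * weight (S (S j)) * step (m + S (S j))))%R; [lra | |].
  + replace (m + S (S j))%nat with (S (m + S j)) by lia.
    replace (S m + j)%nat with (m + S j)%nat by lia.
    set (s := step (m + S j)).
    assert (Hs : (0 <= s)%R) by apply step_pos.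
    generalize (Rmult_le_pos _ _ tame_pos (step_pos j)); intro HK.
    assert (Hw : (weight (S (S j)) * step (S (m + S j)) <= weight (S j) * s)%R).
    { apply Rmult_le_compat; [left; apply exp_pos | apply step_pos | apply weight_decr | apply step_decr]. }
    apply Rle_trans with ((2 * K * s) * ((1 + 2 * K * step j) * weight (S j)))%R.
    * apply Rle_trans with ((1 + K * step j) * (2 * K * weight (S j) * s)
        + (K * step j * (2 * K)) * (weight (S j) * s))%R; [|lra].
      apply Rplus_le_compat_l.
      replace (K * step j * (2 * K * weight (S (S j)) * step (S (m + S j))))%R
        with ((K * step j * (2 * K)) * (weight (S (S j)) * step (S (m + S j))))%R by ring.
      apply Rmult_le_compat_l; [apply Rmult_le_pos; lra | exact Hw].
    * replace (2 * K * weight j * s)%R with ((2 * K * s) * weight j)%R by ring.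
      apply Rmult_le_compat_l; [|apply weight_step].
      apply Rmult_le_pos; lra.
  + apply jet_plus; (apply jet_mult; [lra | | apply IH]); [|apply Hb].
    apply jet_plus; [apply jet_1 | apply Ha].
Qed.

Lemma is_series_correction_bound j :
  is_series (fun m => (2 * K * weight j * step (m + j))%R) (2 * K * weight j * / (INR j + 1))%R.
Proof. apply (is_series_scal (V := R_NormedModule)), is_series_step. Qed.

Lemma correction_summable j :
  ex_series (fun m => Cmod (correction (alpha p) (beta p) m j)).
Proof.
eapply ex_series_Cmod_le; [|eexists; apply is_series_correction_bound].
intro m. exact (jet_at _ _ _ _ (jet_correction m j)).
Qed.

Lemma gauged_near_1 j :
  (Cmod (gauged (alpha p) (beta p) j - 1) <= 2 * K * weight 0 * / (INR j + 1))%R.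
Proof.
generalize tame_pos; intro HK0. unfold gauged.
replace (1 + Csum (fun m => correction (alpha p) (beta p) m j) - 1)
  with (Csum (fun m => correction (alpha p) (beta p) m j)) by ring.
apply Rle_trans with (2 * K * weight j * / (INR j + 1))%R.
- rewrite <- (is_series_unique _ _ (is_series_correction_bound j)).
  apply Csum_norm_le; [|eexists; apply is_series_correction_bound].
  intro m. exact (jet_at _ _ _ _ (jet_correction m j)).
- generalize (pos_INR j); intro.
  apply Rmult_le_compat_r; [left; apply Rinv_0_lt_compat; lra|].
  apply Rmult_le_compat_l; [lra | apply weight_le_0].
Qed.

Lemma jet_gauged j :
  jet p r (1 + 2 * K * weight 0) (fun q => gauged (alpha q) (beta q) j).
Proof.
generalize tame_pos; intro HK0. destruct T as [Hr _ _ _ _]. unfold gauged.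
apply jet_weaken with r (1 + 2 * K * weight j * / (INR j + 1))%R; [lra | |].
- apply Rplus_le_compat_l.
  apply Rle_trans with (2 * K * weight 0 * 1)%R; [|lra].
  generalize (pos_INR j); intro. generalize (weight_ge_1 j); intro.
  apply Rmult_le_compat.
  + apply Rmult_le_pos; lra.
  + left; apply Rinv_0_lt_compat; lra.
  + apply Rmult_le_compat_l; [lra | apply weight_le_0].
  + rewrite <- Rinv_1. apply Rinv_le_contravar; lra.
- apply jet_plus; [apply jet_1|].
  rewrite <- (is_series_unique _ _ (is_series_correction_bound j)).
  apply (jet_Csum p r _ (fun m q => correction (alpha q) (beta q) m j)); [lra | |].
  + intro m. apply jet_correction.
  + eexists; apply is_series_correction_bound.
Qed.

(** Peeling off the zeroth increment [alpha + beta] leaves a series to which the linear recursion of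
    [correction] applies term by term. *)
Lemma gauged_step j :
  gauged (alpha p) (beta p) j
  = (1 + alpha p j) * gauged (alpha p) (beta p) (S j)
    + beta p j * gauged (alpha p) (beta p) (S (S j)).
Proof.
unfold gauged. rewrite Csum_incr_1 by apply correction_summable.
simpl correction.
rewrite Csum_plus, !Csum_scal; try apply correction_summable.
- ring.
- eapply ex_series_ext; [intro n; symmetry; apply Cmod_mult|].
  apply ex_series_scal_R, correction_summable.
- eapply ex_series_ext; [intro n; symmetry; apply Cmod_mult|].
  apply ex_series_scal_R, correction_summable.
Qed.

(** Each factor contributes [K] from [mu] and [K / (i + 1)] from [rho]; the denominators multiply to
    the factorial. *)
Lemma jet_gauge j :
  jet p r ((K * K) ^ j / INR (fact j)) (fun q => gauge (mu q) (rho q) j).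
Proof.
destruct T as [Hr Hmu Hrho _ _].
induction j as [|j IH].
- simpl. unfold Rdiv. rewrite Rinv_1, Rmult_1_l. apply jet_1.
- simpl gauge.
  replace ((K * K) ^ S j / INR (fact (S j)))%R
    with ((K * K) ^ j / INR (fact j) * (K * (K / (INR j + 1))))%R.
  + apply jet_mult; [lra | exact IH|]. apply jet_mult; [lra | exact Hmu | apply Hrho].
  + rewrite fact_simpl, mult_INR, S_INR. simpl pow.
    generalize (pos_INR j) (INR_fact_neq_0 j). intros. field. split; lra.
Qed.

Lemma jet_minimal j :
  jet p r ((K * K) ^ j / INR (fact j) * (1 + 2 * K * weight 0))
    (fun q => minimal (mu q) (rho q) (alpha q) (beta q) j).
Proof.
apply jet_mult; [apply (tame_r _ _ _ _ _ _ _ T) | apply jet_gauge | apply jet_gauged].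
Qed.

Lemma is_series_exp_bound (Z c : R) :
  is_series (fun j => (((K * K) ^ j / INR (fact j) * c) * Z ^ j)%R) (c * exp (K * K * Z))%R.
Proof.
eapply is_series_ext; [|apply (is_series_scal (V := R_NormedModule) c _ _ (is_exp_Reals (K * K * Z)))].
intro n. change (c * ((pow_n (K * K * Z)%R n) * / INR (fact n)) = (K * K) ^ n / INR (fact n) * c * Z ^ n)%R.
rewrite pow_n_pow, Rpow_mult_distr. unfold Rdiv. ring.
Qed.

(** The argument of the power series is itself a function of the parameters, so that its derivative
    is taken jointly with theirs; the majorant is an exponential series. *)
Lemma jet_minimal_sum (Z : R) (zeta : U -> C) : jet p r Z zeta ->
  exists M, jet p r M
    (fun q => Csum (fun j => minimal (mu q) (rho q) (alpha q) (beta q) j * zeta q ^ j)).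
Proof.
intro HZ. eexists.
apply (jet_Csum p r
  (fun j => ((K * K) ^ j / INR (fact j) * (1 + 2 * K * weight 0)) * Z ^ j)%R
  (fun j q => minimal (mu q) (rho q) (alpha q) (beta q) j * zeta q ^ j)).
- generalize (tame_r _ _ _ _ _ _ _ T). lra.
- intro j. apply jet_mult; [apply (tame_r _ _ _ _ _ _ _ T) | apply jet_minimal|].
  apply jet_pow; [apply (tame_r _ _ _ _ _ _ _ T) | exact HZ].
- eexists. apply is_series_exp_bound.
Qed.

Lemma minimal_summable (z : C) :
  ex_series (fun j => Cmod (minimal (mu p) (rho p) (alpha p) (beta p) j * z ^ j)).
Proof.
eapply ex_series_Cmod_le; [|eexists; apply (is_series_exp_bound (Cmod z))].
intro j. rewrite Cmod_mult, Cmod_pow.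
apply Rmult_le_compat_r; [apply pow_le, Cmod_ge_0|].
exact (jet_at _ _ _ _ (jet_minimal j)).
Qed.

Lemma minimal_neq_0 : mu p <> 0 -> (forall i, rho p i <> 0) ->
  exists j, minimal (mu p) (rho p) (alpha p) (beta p) j <> 0.
Proof.
intros Hmu Hrho.
assert (Hg : forall j, gauge (mu p) (rho p) j <> 0).
{ induction j as [|j IH]; simpl; [exact C1_nz|]. repeat apply Cmult_neq_0; auto. }
(* For such [j] the bound of [gauged_near_1] is below 1, so [gauged] cannot vanish there. *)
destruct (INR_unbounded (2 * K * weight 0)) as [j Hj].
exists j. apply Cmult_neq_0; [apply Hg|]. intro E.
generalize (gauged_near_1 j). rewrite E. replace (0 - 1) with (- (1)) by ring.
rewrite Cmod_opp, Cmod_1. intro H.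
generalize (pos_INR j); intro.
assert (H1 : (1 * (INR j + 1) <= 2 * K * weight 0 * / (INR j + 1) * (INR j + 1))%R)
  by (apply Rmult_le_compat_r; lra).
rewrite Rmult_assoc, Rinv_l in H1; lra.
Qed.
End Tame.

(** * Uniqueness through the Casoratian *)

Definition three_term (E A B : nat -> C) (mu : C) (a : nat -> C) : Prop :=
  forall i, E i * a (S i) - mu * A i * a i + mu * B i * a (S (S i)) = 0.

(** Substituting [a j = gauge j * x j] pulls [mu p * gauge i] out of every term and leaves A x_i = E
    rho_i x_(i+1) + mu^2 B rho_i rho_(i+1) x_(i+2). The two hypotheses identify these coefficients
    with [1 + alpha] and [beta], cleared of the denominator [A i]. *)
Lemma minimal_three_term {U : NormedModule C_AbsRing} (p : U) r K mu rho alpha beta E A B :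
  tame p r K mu rho alpha beta ->
  (forall i, A i * (1 + alpha p i) = E i * rho p i) ->
  (forall i, A i * beta p i = mu p * mu p * B i * rho p i * rho p (S i)) ->
  three_term E A B (mu p) (minimal (mu p) (rho p) (alpha p) (beta p)).
Proof.
intros T H1 H2 i. unfold minimal. simpl gauge.
rewrite (gauged_step p r K mu rho alpha beta T i).
set (x := gauged (alpha p) (beta p) (S i)). set (y := gauged (alpha p) (beta p) (S (S i))).
set (c := gauge (mu p) (rho p) i).
transitivity (c * mu p * ((E i * rho p i - A i * (1 + alpha p i)) * x
  + (mu p * mu p * B i * rho p i * rho p (S i) - A i * beta p i) * y)); [ring|].
rewrite H1, H2. ring.
Qed.

Section Uniqueness.
Variables (E A B : nat -> C) (mu : C).
Hypothesis mu_neq_0 : mu <> 0.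
Hypothesis A_neq_0 : forall i, A i <> 0.
Hypothesis B_neq_0 : forall i, B i <> 0.

Lemma three_term_lin a a' c : three_term E A B mu a -> three_term E A B mu a' ->
  three_term E A B mu (fun j => a' j - c * a j).
Proof.
intros H H' i. generalize (H i) (H' i). intros H1 H2.
transitivity ((E i * a' (S i) - mu * A i * a' i + mu * B i * a' (S (S i)))
  - c * (E i * a (S i) - mu * A i * a i + mu * B i * a (S (S i)))); [ring|].
rewrite H1, H2. ring.
Qed.

(** The coefficient [mu * B j] of the highest term is invertible, so two initial values determine a
    solution. *)
Lemma three_term_zero a : three_term E A B mu a -> a 0%nat = 0 -> a 1%nat = 0 ->
  forall j, a j = 0.
Proof.
intros H H0 H1 j. enough (X : a j = 0 /\ a (S j) = 0) by apply X.
induction j as [|j [IH1 IH2]]; [now split|]. split; [exact IH2|].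
generalize (H j). rewrite IH1, IH2. intro X.
assert (HB : mu * B j <> 0) by now apply Cmult_neq_0.
replace (a (S (S j))) with (/ (mu * B j) * (E j * 0 - mu * A j * 0 + mu * B j * a (S (S j))))
  by (field; split; [apply B_neq_0 | exact mu_neq_0]).
rewrite X. ring.
Qed.

Definition casoratian (a a' : nat -> C) (j : nat) : C := a (S j) * a' j - a j * a' (S j).

(** The discrete Abel formula: cross-multiplying the two equations eliminates the middle coefficient
    [E]. *)
Lemma casoratian_step a a' : three_term E A B mu a -> three_term E A B mu a' ->
  forall i, B i * casoratian a a' (S i) = - (A i * casoratian a a' i).
Proof.
intros H H' i. unfold casoratian. generalize (H i) (H' i). intros H1 H2.
assert (X : mu * (B i * (a (S (S i)) * a' (S i) - a (S i) * a' (S (S i)))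
  + A i * (a (S i) * a' i - a i * a' (S i))) = 0).
{ transitivity ((E i * a (S i) - mu * A i * a i + mu * B i * a (S (S i))) * a' (S i)
   - (E i * a' (S i) - mu * A i * a' i + mu * B i * a' (S (S i))) * a (S i)); [ring|].
  rewrite H1, H2. ring. }
set (t := B i * (a (S (S i)) * a' (S i) - a (S i) * a' (S (S i)))) in *.
set (s := A i * (a (S i) * a' i - a i * a' (S i))) in *.
replace t with (/ mu * (mu * (t + s)) - s) by (field; exact mu_neq_0).
rewrite X. ring.
Qed.

(** A vanishing Casoratian at 0 makes the pairs of initial values parallel; the pair of [a] is not
    zero because [a] is not, and proportional initial values propagate. *)
Lemma three_term_proportional a a' : three_term E A B mu a -> three_term E A B mu a' ->
  (exists j, a j <> 0) -> casoratian a a' 0 = 0 -> exists c, forall j, a' j = c * a j.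
Proof.
intros H H' [j Hj] HW. unfold casoratian in HW.
assert (X : exists c, a' 0%nat = c * a 0%nat /\ a' 1%nat = c * a 1%nat).
{ destruct (Ceq_dec (a 0%nat) 0) as [H0|H0].
  - assert (H1 : a 1%nat <> 0) by (intro H1; exact (Hj (three_term_zero a H H0 H1 j))).
    exists (a' 1%nat / a 1%nat). split; [|field; exact H1].
    rewrite H0 in *.
    replace (a' 0%nat) with (/ a 1%nat * (a 1%nat * a' 0%nat - 0 * a' 1%nat)) by (field; exact H1).
    rewrite HW. ring.
  - exists (a' 0%nat / a 0%nat). split; [field; exact H0|].
    replace (a' 1%nat) with (a' 0%nat / a 0%nat * a 1%nat
      - / a 0%nat * (a 1%nat * a' 0%nat - a 0%nat * a' 1%nat)) by (field; exact H0).
    rewrite HW. ring. }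
destruct X as [c [X0 X1]]. exists c. intro k.
assert (Z : a' k - c * a k = 0).
{ apply (three_term_zero (fun j => a' j - c * a j)).
  - now apply three_term_lin.
  - rewrite X0. ring.
  - rewrite X1. ring. }
replace (a' k) with ((a' k - c * a k) + c * a k) by ring. rewrite Z. ring.
Qed.

Lemma pow2_bounded_nonpos (x M : R) : (forall j, (x * 2 ^ j <= M)%R) -> (x <= 0)%R.
Proof.
intro H. apply Rnot_lt_le. intro Hx.
assert (P : forall j, (INR j <= 2 ^ j)%R).
{ intro j. induction j as [|j IH]; [simpl; lra|]. rewrite S_INR. simpl pow.
  generalize (pow_R1_Rle 2 j). lra. }
destruct (INR_unbounded (M / x)) as [j Hj].
assert (X : (x * (M / x) < x * INR j)%R) by (apply Rmult_lt_compat_l; assumption).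
replace (x * (M / x))%R with M in X by (field; lra).
generalize (H j) (Rmult_le_compat_l x _ _ (Rlt_le _ _ Hx) (P j)). lra.
Qed.

(* The Casoratian of two solutions decays at most geometrically, whereas for
   an entire [a] and an [a'] of positive radius it decays faster. *)
Lemma three_term_unique Q a a' : (0 < Q)%R -> (forall i, (Cmod (B i) <= Q * Cmod (A i))%R) ->
  three_term E A B mu a -> three_term E A B mu a' -> (exists j, a j <> 0) ->
  (forall R, (0 < R)%R -> exists M, forall j, (Cmod (a j) * R ^ j <= M)%R) ->
  (exists s M, (0 < s)%R /\ forall j, (Cmod (a' j) * s ^ j <= M)%R) ->
  exists c, forall j, a' j = c * a j.
Proof.
intros HQ HAB H H' Hnz Ha (s & M' & Hs & HM').
apply three_term_proportional; auto.
set (w := casoratian a a').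
assert (W : forall j, (Cmod (w 0%nat) <= Q ^ j * Cmod (w j))%R).
{ induction j as [|j IH]; [simpl; lra|].
  eapply Rle_trans; [exact IH|]. simpl pow.
  replace (Q * Q ^ j * Cmod (w (S j)))%R with (Q ^ j * (Q * Cmod (w (S j))))%R by ring.
  apply Rmult_le_compat_l; [apply pow_le; lra|].
  assert (HA : (0 < Cmod (A j))%R) by (apply Cmod_gt_0, A_neq_0).
  apply Rmult_le_reg_l with (Cmod (A j)); [exact HA|].
  replace (Cmod (A j) * Cmod (w j))%R with (Cmod (B j) * Cmod (w (S j)))%R.
  2:{ rewrite <- !Cmod_mult. unfold w. rewrite (casoratian_step a a' H H' j). apply Cmod_opp. }
  replace (Cmod (A j) * (Q * Cmod (w (S j))))%R with ((Q * Cmod (A j)) * Cmod (w (S j)))%R by ring.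
  apply Rmult_le_compat_r; [apply Cmod_ge_0 | apply HAB]. }
(* Chosen so that [R0 * s = 2 * Q]: the Casoratian is then O((2 Q)^(-j)), which beats its lower
   bound of order Q^(-j) by the factor 2^j. *)
set (R0 := (2 * Q / s)%R).
assert (HR : (0 < R0)%R) by (apply Rdiv_lt_0_compat; lra).
destruct (Ha R0 HR) as [M HM].
assert (M0 : (0 <= M)%R) by (generalize (HM 0%nat) (Cmod_ge_0 (a 0%nat)); simpl; lra).
assert (M0' : (0 <= M')%R) by (generalize (HM' 0%nat) (Cmod_ge_0 (a' 0%nat)); simpl; lra).
assert (V : forall j, (Cmod (w j) * (2 * Q) ^ S j <= M * M' * (s + R0))%R).
{ intro j. replace (2 * Q)%R with (R0 * s)%R by (unfold R0; field; lra).
  apply Rle_trans with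
    ((Cmod (a (S j)) * R0 ^ S j) * ((Cmod (a' j) * s ^ j) * s)
     + ((Cmod (a j) * R0 ^ j) * R0) * (Cmod (a' (S j)) * s ^ S j))%R.
  - rewrite Rpow_mult_distr.
    replace ((Cmod (a (S j)) * R0 ^ S j) * ((Cmod (a' j) * s ^ j) * s)
     + ((Cmod (a j) * R0 ^ j) * R0) * (Cmod (a' (S j)) * s ^ S j))%R
    with ((Cmod (a (S j)) * Cmod (a' j) + Cmod (a j) * Cmod (a' (S j))) * (R0 ^ S j * s ^ S j))%R
      by (simpl; ring).
    apply Rmult_le_compat_r; [apply Rmult_le_pos; apply pow_le; lra|].
    unfold w, casoratian. eapply Rle_trans; [apply Cmod_triangle|].
    rewrite Cmod_opp, !Cmod_mult. lra.
  - replace (M * M' * (s + R0))%R with (M * (M' * s) + (M * R0) * M')%R by ring.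
    assert (P : forall x y z, (0 <= Cmod x -> 0 < y -> 0 <= Cmod x * y ^ z)%R)
      by (intros; apply Rmult_le_pos; [assumption | apply pow_le; lra]).
    apply Rplus_le_compat; apply Rmult_le_compat; try apply HM; try apply HM';
      try (apply P; auto using Cmod_ge_0);
      try (apply Rmult_le_pos; [apply P; auto using Cmod_ge_0 | lra]);
      apply Rmult_le_compat_r; try lra; try apply HM; apply HM'. }
assert (Z : (Cmod (w 0%nat) * (2 * Q) <= 0)%R).
{ apply pow2_bounded_nonpos with (M * M' * (s + R0))%R. intro j.
  eapply Rle_trans; [|apply (V j)].
  replace (Cmod (w j) * (2 * Q) ^ S j)%R with ((Q ^ j * Cmod (w j)) * (2 * Q * 2 ^ j))%R.
  2:{ simpl. rewrite Rpow_mult_distr. ring. }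
  rewrite Rmult_assoc. apply Rmult_le_compat_r; [|apply W].
  generalize (pow_le 2 j). intro. apply Rmult_le_pos; lra. }
apply Cmod_eq_0. generalize (Cmod_ge_0 (w 0%nat)). intro Hw.
apply Rle_antisym; [|exact Hw].
apply Rmult_le_reg_r with (2 * Q)%R; lra.
Qed.
End Uniqueness.

(** * Gauges for the upper and the lower recurrences *)

(** Equation number [i] is centred at distance [i + 1] from [k0], hence the [i + 1]. *)
Definition shifted (w : C) (i : nat) : C := RtoC (INR i + 1) + w.

Lemma shifted_S w i : shifted w (S i) = shifted w i + 1.
Proof. unfold shifted. rewrite S_INR, !RtoC_plus. ring. Qed.

Definition nonvanishing (u v : C) : Prop := forall i, shifted u i <> 0 /\ shifted v i <> 0.

(** Once i exceeds 2|w|, the modulus of i + 1 + w is at least (i+1)/2; the finitely many earlier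
    indices are handled by a minimum of positive quotients. *)
Lemma shifted_lower_bound w : (forall i, shifted w i <> 0) ->
  exists d, (0 < d)%R /\ forall i, (d * (INR i + 1) <= Cmod (shifted w i))%R.
Proof.
intro H.
assert (F : forall N, exists d, (0 < d)%R /\
  forall i, (i < N)%nat -> (d * (INR i + 1) <= Cmod (shifted w i))%R).
{ induction N as [|N [d [Hd IH]]]; [exists 1%R; split; [lra | lia]|].
  generalize (proj1 (Cmod_gt_0 _) (H N)) (pos_INR N). intros HN PN.
  set (e := (Cmod (shifted w N) / (INR N + 1))%R).
  assert (He : (0 < e)%R) by (apply Rdiv_lt_0_compat; lra).
  exists (Rmin d e). split; [now apply Rmin_glb_lt|]. intros i Hi.
  generalize (Rmin_l d e) (Rmin_r d e) (pos_INR i). intros H1 H2 Pi.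
  destruct (PeanoNat.Nat.eq_dec i N) as [->|Hn].
  - apply Rle_trans with (e * (INR N + 1))%R; [apply Rmult_le_compat_r; lra|].
    right. unfold e. field. lra.
  - apply Rle_trans with (d * (INR i + 1))%R; [apply Rmult_le_compat_r; lra|]. apply IH. lia. }
destruct (INR_unbounded (2 * Cmod w)) as [N HN].
destruct (F N) as [d [Hd HF]].
exists (Rmin d (1 / 2)). split; [apply Rmin_glb_lt; lra|]. intro i.
generalize (Rmin_l d (1 / 2)) (Rmin_r d (1 / 2)) (pos_INR i). intros H1 H2 Pi.
destruct (Compare_dec.lt_dec i N) as [Hi|Hi].
- apply Rle_trans with (d * (INR i + 1))%R; [apply Rmult_le_compat_r; lra|]. now apply HF.
- apply Rle_trans with (1 / 2 * (INR i + 1))%R; [apply Rmult_le_compat_r; lra|].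
  assert (HiN : (INR N <= INR i)%R) by (apply le_INR; lia).
  generalize (Cmod_triangle (shifted w i) (- w)).
  replace (shifted w i + - w) with (RtoC (INR i + 1)) by (unfold shifted; ring).
  rewrite Cmod_opp, Cmod_R, Rabs_pos_eq by lra. lra.
Qed.

(** Supplies the constant [Q] of [three_term_unique]: both sides grow linearly in [i], and the
    right-hand one is bounded below by [shifted_lower_bound]. *)
Lemma shifted_ratio u v : (forall i, shifted u i <> 0) ->
  exists Q, (0 < Q)%R /\ forall i, (Cmod (shifted v i) <= Q * Cmod (shifted u i))%R.
Proof.
intro H. destruct (shifted_lower_bound u H) as [d [Hd Hu]].
generalize (Cmod_ge_0 v); intro Hv.
assert (HQ : (0 < (1 + Cmod v) / d)%R) by (apply Rdiv_lt_0_compat; lra).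
exists ((1 + Cmod v) / d)%R. split; [exact HQ|]. intro i.
generalize (pos_INR i); intro Pi.
apply Rle_trans with ((1 + Cmod v) / d * (d * (INR i + 1)))%R.
2:{ apply Rmult_le_compat_l; [lra | apply Hu]. }
replace ((1 + Cmod v) / d * (d * (INR i + 1)))%R with (INR i + 1 + Cmod v * (INR i + 1))%R
  by (field; lra).
unfold shifted. eapply Rle_trans; [apply Cmod_triangle|].
rewrite Cmod_R, Rabs_pos_eq by lra. apply Rplus_le_compat_l.
rewrite <- (Rmult_1_r (Cmod v)) at 1. apply Rmult_le_compat_l; lra.
Qed.

(** One ball works for all [i], since the lower bound [d * (i + 1)] of the denominator is smallest
    at [i = 0]. The higher powers of 1/(i+1) that come from the derivative and the remainder are
    bounded by the first. *)
Lemma jet_inv_shifted {U : NormedModule C_AbsRing} (p : U) r K w : (0 < r <= 1)%R ->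
  jet p r K w -> (forall i, shifted (w p) i <> 0) ->
  exists r' K', (0 < r' <= r)%R /\
    forall i, jet p r' (K' / (INR i + 1)) (fun q => / shifted (w q) i).
Proof.
intros Hr Hw Hnz. generalize (jet_pos _ _ _ _ Hw); intro HK.
destruct (shifted_lower_bound (w p) Hnz) as [d [Hd Hl]].
assert (He : (0 < d / (2 * K + 1))%R) by (apply Rdiv_lt_0_compat; lra).
set (r' := Rmin r (d / (2 * K + 1))).
assert (H1 : (0 < r')%R) by (apply Rmin_glb_lt; lra).
assert (H2 : (r' <= r)%R) by apply Rmin_l.
assert (H3 : (2 * (K * r') <= d)%R).
{ apply Rle_trans with ((2 * K + 1) * (d / (2 * K + 1)))%R.
  - rewrite <- Rmult_assoc. apply Rmult_le_compat; try lra. apply Rmin_r.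
  - right. field. lra. }
exists r', (/ d + 2 * K / d ^ 2 + 2 * K ^ 2 / d ^ 3)%R. split; [lra|]. intro i.
generalize (pos_INR i); intro Pi.
assert (Hdi : (d <= d * (INR i + 1))%R)
  by (rewrite <- (Rmult_1_r d) at 1; apply Rmult_le_compat_l; lra).
eapply jet_weaken; [apply Rle_refl | | apply (jet_inv _ p r' K (d * (INR i + 1)) w)]; try lra.
- set (t := (/ (INR i + 1))%R).
  assert (Ht : (0 <= t <= 1)%R).
  { unfold t. split; [left; apply Rinv_0_lt_compat; lra|].
    rewrite <- Rinv_1. apply Rinv_le_contravar; lra. }
  replace (/ (d * (INR i + 1)) + 2 * K / (d * (INR i + 1)) ^ 2 + 2 * K ^ 2 / (d * (INR i + 1)) ^ 3)%R
    with ((/ d * t + 2 * K / d ^ 2 * (t * t)) + 2 * K ^ 2 / d ^ 3 * (t * (t * t)))%R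
    by (unfold t; field; lra).
  replace ((/ d + 2 * K / d ^ 2 + 2 * K ^ 2 / d ^ 3) / (INR i + 1))%R
    with ((/ d * t + 2 * K / d ^ 2 * (t * 1)) + 2 * K ^ 2 / d ^ 3 * (t * (1 * 1)))%R
    by (unfold t; field; lra).
  assert (T2 : (t * t <= t * 1)%R) by (apply Rmult_le_compat_l; lra).
  assert (T3 : (t * (t * t) <= t * (1 * 1))%R)
    by (apply Rmult_le_compat_l; [lra|]; apply Rmult_le_compat; lra).
  apply Rplus_le_compat; [apply Rplus_le_compat_l|].
  + apply Rmult_le_compat_l; [|exact T2].
    apply Rmult_le_pos; [lra|]. left. apply Rinv_0_lt_compat, pow_lt, Hd.
  + apply Rmult_le_compat_l; [|exact T3].
    apply Rmult_le_pos; [apply Rmult_le_pos; [lra | now apply pow_le]|].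
    left. apply Rinv_0_lt_compat, pow_lt, Hd.
- apply Hl.
- apply jet_weaken with r K; auto with real.
Qed.

(* Both halves of the recurrence, indexed by the distance [j] to [k0], take the form
   [E i * a (S i) - mu * (i + 1 + u) * a i + mu * (i + 1 + v) * a (S (S i)) = 0]
   with [E = s_main u v lambda].  A scheme provides a gauge [rho] such that
   [a j = x j * prod_(i < j) mu * rho i] turns it into the recursion solved by
   [gauged], with [alpha] and [beta] of order [1 / i^2] locally uniformly. *)
Record scheme : Type := {
  s_main : C -> C -> C -> nat -> C;
  s_rho : C -> nat -> C;
  s_alpha : C -> C -> C -> nat -> C;
  s_beta : C -> C -> C -> nat -> C;
  s_rho_neq_0 : forall u v i, nonvanishing u v -> s_rho v i <> 0;
  s_alpha_eq : forall u v lambda i, nonvanishing u v ->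
    shifted u i * (1 + s_alpha u v lambda i) = s_main u v lambda i * s_rho v i;
  s_beta_eq : forall u v mu i, nonvanishing u v ->
    shifted u i * s_beta u v mu i = mu * mu * shifted v i * s_rho v i * s_rho v (S i);
  s_tame : forall (U : NormedModule C_AbsRing) (p : U) r K (u v lambda mu : U -> C),
    (0 < r <= 1)%R -> jet p r K u -> jet p r K v -> jet p r K lambda -> jet p r K mu ->
    nonvanishing (u p) (v p) ->
    exists r' K', (0 < r' <= r)%R /\
      tame p r' K' mu (fun q => s_rho (v q)) (fun q => s_alpha (u q) (v q) (lambda q))
        (fun q => s_beta (u q) (v q) (mu q)) }.

(** With k = k0 + i + 1, the factors [shifted v i - 1] and [shifted u i] are k + b and k + b + n -
    1. *)
Definition upper_main (u v lambda : C) (i : nat) : C :=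
  (shifted v i - 1) * shifted u i + lambda.

(* The naive factor [/ (i + v)] may be singular at [i = 0]; one value is
   immaterial for the asymptotics and is replaced by 1. *)
Definition upper_rho (v : C) (i : nat) : C :=
  match i with O => 1 | S i' => / shifted v i' end.

(** For positive [i] the gauge cancels [shifted v i - 1] exactly and only the [lambda] term remains;
    [v - 1] is the defect caused by the value 1 of the gauge at 0. *)
Definition upper_alpha (u v lambda : C) (i : nat) : C :=
  lambda * upper_rho v i * / shifted u i + match i with O => v - 1 | S _ => 0 end.

Definition upper_beta (u v mu : C) (i : nat) : C :=
  mu * mu * (upper_rho v i * / shifted u i).

(** With k = k0 - i - 1, the two factors are -(k + b) and -(k + b + n - 1); the signs cancel in the
    product. *)
Definition lower_main (u v lambda : C) (i : nat) : C :=
  (shifted u i + 1) * shifted v i + lambda.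

(** With U and V for [shifted u i] and [shifted v i], the main coefficient divided by U is (1 + 1/U)
    V up to O(1/i). The gauge 1/V would leave an error 1/U, which is not summable; 1/(V+1)
    compensates it, as V - U does not depend on i. *)
Definition lower_rho (v : C) (i : nat) : C := / shifted v (S i).

Definition lower_alpha (u v lambda : C) (i : nat) : C :=
  (v + (- (1)) * u + lambda) * (lower_rho v i * / shifted u i).

(** The parenthesis with [lower_rho v i] is V/(V+1) = 1 - 1/(V+1) for V = [shifted v i], written
    with bounded factors only. *)
Definition lower_beta (u v mu : C) (i : nat) : C :=
  mu * mu * (1 + (- (1)) * lower_rho v i) * (lower_rho v (S i) * / shifted u i).

Lemma inv_neq_0 (z : C) : z <> 0 -> / z <> 0.
Proof.
intros Hz E. apply C1_nz. rewrite <- (Cinv_r z Hz), E. ring.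
Qed.

Lemma upper_rho_neq_0 u v i : nonvanishing u v -> upper_rho v i <> 0.
Proof. intro H. destruct i as [|i]; [exact C1_nz | apply inv_neq_0, H]. Qed.

Lemma lower_rho_neq_0 u v i : nonvanishing u v -> lower_rho v i <> 0.
Proof. intro H. apply inv_neq_0, H. Qed.

Lemma upper_alpha_eq u v lambda i : nonvanishing u v ->
  shifted u i * (1 + upper_alpha u v lambda i) = upper_main u v lambda i * upper_rho v i.
Proof.
intro H. destruct (H i) as [Hu Hv]. unfold upper_alpha, upper_main, upper_rho.
destruct i as [|i].
- unfold shifted in *. simpl INR in *. rewrite Rplus_0_l in *. field. exact Hu.
- destruct (H i) as [_ Hv']. rewrite (shifted_S v). field. split; assumption.
Qed.

Lemma upper_beta_eq u v mu i : nonvanishing u v ->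
  shifted u i * upper_beta u v mu i = mu * mu * shifted v i * upper_rho v i * upper_rho v (S i).
Proof.
intro H. destruct (H i) as [Hu Hv]. unfold upper_beta. simpl (upper_rho v (S i)).
field. split; assumption.
Qed.

Lemma lower_alpha_eq u v lambda i : nonvanishing u v ->
  shifted u i * (1 + lower_alpha u v lambda i) = lower_main u v lambda i * lower_rho v i.
Proof.
intro H. destruct (H i) as [Hu _]. destruct (H (S i)) as [_ Hv].
unfold lower_alpha, lower_main, lower_rho. rewrite shifted_S in *.
(* Since v - u is the difference of the shifted values, the identity becomes rational in those
   alone. *)
replace v with (shifted v i - RtoC (INR i + 1)) at 1 by (unfold shifted; ring).
replace u with (shifted u i - RtoC (INR i + 1)) at 2 by (unfold shifted; ring).
field. split; assumption.
Qed.

Lemma lower_beta_eq u v mu i : nonvanishing u v ->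
  shifted u i * lower_beta u v mu i = mu * mu * shifted v i * lower_rho v i * lower_rho v (S i).
Proof.
intro H. destruct (H i) as [Hu _]. destruct (H (S i)) as [_ Hv]. destruct (H (S (S i))) as [_ Hv'].
unfold lower_beta, lower_rho. rewrite !shifted_S in *.
field. repeat split; assumption.
Qed.

Section SchemeJets.
Context {U : NormedModule C_AbsRing}.
Variables (p : U) (r K : R) (u v lambda mu : U -> C).
Hypothesis r_range : (0 < r <= 1)%R.
Hypothesis K_ge_1 : (1 <= K)%R.
Hypothesis u_jet : jet p r K u.
Hypothesis v_jet : jet p r K v.
Hypothesis lambda_jet : jet p r K lambda.
Hypothesis mu_jet : jet p r K mu.
Hypothesis inv_u_jet : forall i, jet p r (K / (INR i + 1)) (fun q => / shifted (u q) i).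
Hypothesis inv_v_jet : forall i, jet p r (K / (INR i + 1)) (fun q => / shifted (v q) i).

(** The degree 5 comes from [lower_beta], of size K^4 + K^5, and the factor 8 from [upper_alpha], of
    size 4 K^3 + 4 K. *)
Let bound := (8 * K ^ 5)%R.

Lemma pow_le_bound n : (n <= 5)%nat -> (K ^ n <= K ^ 5)%R.
Proof. intro H. apply Rle_pow; assumption. Qed.

(** The factor 2 pays for the index shift in [upper_rho]: 1/(i+1) <= 2/(i+2). *)
Lemma jet_upper_rho i : jet p r (2 * K / (INR i + 1)) (fun q => upper_rho (v q) i).
Proof.
destruct i as [|i].
- apply jet_weaken with r 1%R; [lra | | apply jet_1]. simpl. lra.
- apply jet_weaken with r (K / (INR i + 1))%R; [lra | | apply inv_v_jet].
  rewrite S_INR. generalize (pos_INR i); intro Pi.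
  apply Rminus_le_0.
  replace (2 * K / (INR i + 1 + 1) - K / (INR i + 1))%R
    with (K * INR i * / ((INR i + 1) * (INR i + 1 + 1)))%R by (field; lra).
  apply Rmult_le_pos; [apply Rmult_le_pos; lra|].
  left. apply Rinv_0_lt_compat, Rmult_lt_0_compat; lra.
Qed.

Lemma inv_sqr_le_step i : (/ ((INR i + 1) * (INR i + 1)) <= 2 * step i)%R.
Proof.
rewrite step_eq. generalize (pos_INR i); intro Pi. apply Rminus_le_0.
replace (2 * / ((INR i + 1) * (INR i + 2)) - / ((INR i + 1) * (INR i + 1)))%R
  with (INR i * / ((INR i + 1) * (INR i + 1) * (INR i + 2)))%R by (field; lra).
apply Rmult_le_pos; [lra|].
left. apply Rinv_0_lt_compat. repeat apply Rmult_lt_0_compat; lra.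
Qed.

Lemma jet_upper_quotient i :
  jet p r (4 * K ^ 2 * step i) (fun q => upper_rho (v q) i * / shifted (u q) i).
Proof.
apply jet_weaken with r (2 * K / (INR i + 1) * (K / (INR i + 1)))%R; [lra | |].
- generalize (pos_INR i) (inv_sqr_le_step i); intros Pi Hs.
  replace (2 * K / (INR i + 1) * (K / (INR i + 1)))%R
    with (2 * K ^ 2 * / ((INR i + 1) * (INR i + 1)))%R by (field; lra).
  replace (4 * K ^ 2 * step i)%R with (2 * K ^ 2 * (2 * step i))%R by ring.
  apply Rmult_le_compat_l; [|exact Hs].
  generalize (pow_R1_Rle K 2 K_ge_1). lra.
- apply jet_mult; [lra | apply jet_upper_rho | apply inv_u_jet].
Qed.

Lemma upper_scheme_tame : tame p r bound mu (fun q => upper_rho (v q))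
  (fun q => upper_alpha (u q) (v q) (lambda q)) (fun q => upper_beta (u q) (v q) (mu q)).
Proof.
generalize (pow_le_bound 1) (pow_le_bound 3) (pow_le_bound 4) (pow_R1_Rle K 5 K_ge_1).
rewrite pow_1. intros B1 B3 B4 B5.
specialize (B1 ltac:(lia)). specialize (B3 ltac:(lia)). specialize (B4 ltac:(lia)).
split; auto.
- apply jet_weaken with r K; [lra | unfold bound; lra | exact mu_jet].
- intro i. apply jet_weaken with r (2 * K / (INR i + 1))%R; [lra | | apply jet_upper_rho].
  generalize (pos_INR i); intro Pi.
  apply Rmult_le_compat_r; [left; apply Rinv_0_lt_compat; lra | unfold bound; lra].
- intro i. unfold upper_alpha.
  apply jet_weaken with r (K * (4 * K ^ 2 * step i) + 4 * K * step i)%R; [lra | |].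
  + replace (K * (4 * K ^ 2 * step i) + 4 * K * step i)%R
      with ((4 * K ^ 3 + 4 * K) * step i)%R by ring.
    apply Rmult_le_compat_r; [apply step_pos | unfold bound; lra].
  + apply jet_plus.
    * apply jet_ext with (fun q => lambda q * (upper_rho (v q) i * / shifted (u q) i));
        [intro q; ring|].
      apply jet_mult; [lra | exact lambda_jet | apply jet_upper_quotient].
    (* [step 0] is 1/2, so the exceptional term, of size K + 1, fits into 2 K. *)
    * destruct i as [|i].
      -- apply jet_weaken with r (K + Cmod (- (1)))%R; [lra | |].
         ++ rewrite Cmod_opp, Cmod_1, step_eq. simpl. lra.
         ++ apply jet_plus; [exact v_jet | apply jet_const].
      -- apply jet_weaken with r (Cmod 0); [lra | | apply jet_const].
         rewrite Cmod_0. generalize (step_pos (S i)); intro. apply Rmult_le_pos; lra.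
- intro i. unfold upper_beta.
  apply jet_weaken with r (K * K * (4 * K ^ 2 * step i))%R; [lra | |].
  + replace (K * K * (4 * K ^ 2 * step i))%R with (4 * K ^ 4 * step i)%R by ring.
    apply Rmult_le_compat_r; [apply step_pos | unfold bound; lra].
  + apply jet_mult; [lra | | apply jet_upper_quotient]. apply jet_mult; auto. lra.
Qed.

Lemma jet_lower_rho i : jet p r (K / (INR i + 2)) (fun q => lower_rho (v q) i).
Proof.
replace (INR i + 2)%R with (INR (S i) + 1)%R by (rewrite S_INR; ring). apply inv_v_jet.
Qed.

Lemma lower_scheme_tame : tame p r bound mu (fun q => lower_rho (v q))
  (fun q => lower_alpha (u q) (v q) (lambda q)) (fun q => lower_beta (u q) (v q) (mu q)).
Proof.
generalize (pow_le_bound 1) (pow_le_bound 3) (pow_le_bound 4) (pow_R1_Rle K 5 K_ge_1).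
rewrite pow_1. intros B1 B3 B4 B5.
specialize (B1 ltac:(lia)). specialize (B3 ltac:(lia)). specialize (B4 ltac:(lia)).
split; auto.
- apply jet_weaken with r K; [lra | unfold bound; lra | exact mu_jet].
- intro i. apply jet_weaken with r (K / (INR i + 2))%R; [lra | | apply jet_lower_rho].
  generalize (pos_INR i); intro Pi.
  apply Rmult_le_compat; [lra | left; apply Rinv_0_lt_compat; lra | unfold bound; lra |].
  apply Rinv_le_contravar; lra.
- intro i. unfold lower_alpha. generalize (pos_INR i); intro Pi.
  apply jet_weaken with r
    ((K + Cmod (- (1)) * K + K) * (K / (INR i + 2) * (K / (INR i + 1))))%R; [lra | |].
  + rewrite Cmod_opp, Cmod_1.
    replace ((K + 1 * K + K) * (K / (INR i + 2) * (K / (INR i + 1))))%R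
      with (3 * K ^ 3 * step i)%R by (rewrite step_eq; field; lra).
    apply Rmult_le_compat_r; [apply step_pos | unfold bound; lra].
  + apply jet_mult; [lra | | apply jet_mult; [lra | apply jet_lower_rho | apply inv_u_jet]].
    repeat apply jet_plus; auto. apply jet_mult; [lra | apply jet_const | exact u_jet].
- intro i. unfold lower_beta. generalize (pos_INR i); intro Pi.
  apply jet_weaken with r
    (K * K * (1 + Cmod (- (1)) * (K / (INR i + 2))) * (K / (INR (S i) + 2) * (K / (INR i + 1))))%R;
    [lra | |].
  + rewrite Cmod_opp, Cmod_1, S_INR, Rmult_1_l.
    apply Rle_trans with (K * K * (1 + K) * (K * K * step i))%R.
    * apply Rmult_le_compat.
      -- repeat apply Rmult_le_pos; try lra.
         assert (0 <= K / (INR i + 2))%R by (apply Rmult_le_pos; [lra | left; apply Rinv_0_lt_compat; lra]).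
         lra.
      -- apply Rmult_le_pos; apply Rmult_le_pos; try lra; left; apply Rinv_0_lt_compat; lra.
      -- apply Rmult_le_compat_l; [apply Rmult_le_pos; lra|]. apply Rplus_le_compat_l.
         rewrite <- (Rmult_1_r K) at 2. apply Rmult_le_compat_l; [lra|].
         rewrite <- Rinv_1. apply Rinv_le_contravar; lra.
      -- replace (K * K * step i)%R with (K / (INR i + 2) * (K / (INR i + 1)))%R
           by (rewrite step_eq; field; lra).
         apply Rmult_le_compat_r.
         ++ apply Rmult_le_pos; [lra|]. left; apply Rinv_0_lt_compat; lra.
         ++ apply Rmult_le_compat_l; [lra|]. apply Rinv_le_contravar; lra.
    * replace (K * K * (1 + K) * (K * K * step i))%R with ((K ^ 4 + K ^ 5) * step i)%R by ring.
      apply Rmult_le_compat_r; [apply step_pos | unfold bound; lra].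
  + apply jet_mult; [lra | | apply jet_mult; [lra | apply jet_lower_rho | apply inv_u_jet]].
    apply jet_mult; [lra | apply jet_mult; auto; lra |].
    apply jet_plus; [apply jet_1|]. apply jet_mult; [lra | apply jet_const | apply jet_lower_rho].
Qed.
End SchemeJets.

Lemma jet_common_bound {U : NormedModule C_AbsRing} (p : U) r K (u v lambda mu : U -> C) :
  (0 < r <= 1)%R -> jet p r K u -> jet p r K v -> jet p r K lambda -> jet p r K mu ->
  nonvanishing (u p) (v p) ->
  exists r' K', (0 < r' <= r)%R /\ (1 <= K')%R /\
    jet p r' K' u /\ jet p r' K' v /\ jet p r' K' lambda /\ jet p r' K' mu /\
    (forall i, jet p r' (K' / (INR i + 1)) (fun q => / shifted (u q) i)) /\
    (forall i, jet p r' (K' / (INR i + 1)) (fun q => / shifted (v q) i)).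
Proof.
intros Hr Hu Hv Hl Hm Hnz.
destruct (jet_inv_shifted p r K u Hr Hu (fun i => proj1 (Hnz i))) as (r1 & K1 & Hr1 & H1).
assert (Hr1' : (0 < r1 <= 1)%R) by lra.
destruct (jet_inv_shifted p r1 K v Hr1' (jet_weaken _ _ _ _ _ _ (proj2 Hr1) (Rle_refl K) Hv)
  (fun i => proj2 (Hnz i))) as (r2 & K2 & Hr2 & H2).
generalize (jet_pos _ _ _ _ Hu); intro HK.
assert (HK1 : (0 <= K1)%R) by (generalize (jet_pos _ _ _ _ (H1 0%nat)); simpl; lra).
assert (HK2 : (0 <= K2)%R) by (generalize (jet_pos _ _ _ _ (H2 0%nat)); simpl; lra).
exists r2, (1 + K + K1 + K2)%R.
assert (W : forall M i, (0 <= M <= 1 + K + K1 + K2)%R ->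
  (M / (INR i + 1) <= (1 + K + K1 + K2) / (INR i + 1))%R).
{ intros M i HM. generalize (pos_INR i); intro.
  apply Rmult_le_compat_r; [left; apply Rinv_0_lt_compat; lra | lra]. }
split; [lra|]. split; [lra|].
repeat split; try (apply jet_weaken with r K; auto; lra); intro i.
- apply jet_weaken with r1 (K1 / (INR i + 1))%R; [lra | apply W; lra | apply H1].
- apply jet_weaken with r2 (K2 / (INR i + 1))%R; [lra | apply W; lra | apply H2].
Qed.

Lemma upper_gauge_tame (U : NormedModule C_AbsRing) (p : U) r K (u v lambda mu : U -> C) :
  (0 < r <= 1)%R -> jet p r K u -> jet p r K v -> jet p r K lambda -> jet p r K mu ->
  nonvanishing (u p) (v p) ->
  exists r' K', (0 < r' <= r)%R /\
    tame p r' K' mu (fun q => upper_rho (v q)) (fun q => upper_alpha (u q) (v q) (lambda q))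
      (fun q => upper_beta (u q) (v q) (mu q)).
Proof.
intros Hr Hu Hv Hl Hm Hnv.
destruct (jet_common_bound p r K u v lambda mu Hr Hu Hv Hl Hm Hnv) as (r' & K' & Hr' & HK & H').
exists r', (8 * K' ^ 5)%R. split; [exact Hr'|].
apply upper_scheme_tame; try apply H'; lra.
Qed.

Definition upper_scheme : scheme := {|
  s_main := upper_main; s_rho := upper_rho; s_alpha := upper_alpha; s_beta := upper_beta;
  s_rho_neq_0 := upper_rho_neq_0; s_alpha_eq := upper_alpha_eq; s_beta_eq := upper_beta_eq;
  s_tame := upper_gauge_tame |}.

Lemma lower_gauge_tame (U : NormedModule C_AbsRing) (p : U) r K (u v lambda mu : U -> C) :
  (0 < r <= 1)%R -> jet p r K u -> jet p r K v -> jet p r K lambda -> jet p r K mu ->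
  nonvanishing (u p) (v p) ->
  exists r' K', (0 < r' <= r)%R /\
    tame p r' K' mu (fun q => lower_rho (v q)) (fun q => lower_alpha (u q) (v q) (lambda q))
      (fun q => lower_beta (u q) (v q) (mu q)).
Proof.
intros Hr Hu Hv Hl Hm Hnv.
destruct (jet_common_bound p r K u v lambda mu Hr Hu Hv Hl Hm Hnv) as (r' & K' & Hr' & HK & H').
exists r', (8 * K' ^ 5)%R. split; [exact Hr'|].
apply lower_scheme_tame; try apply H'; lra.
Qed.

Definition lower_scheme : scheme := {|
  s_main := lower_main; s_rho := lower_rho; s_alpha := lower_alpha; s_beta := lower_beta;
  s_rho_neq_0 := lower_rho_neq_0; s_alpha_eq := lower_alpha_eq; s_beta_eq := lower_beta_eq;
  s_tame := lower_gauge_tame |}.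

(** * Existence, uniqueness and differentiability for a general scheme *)

Section SchemeSolutions.
Variable sch : scheme.

Definition scheme_recurrence (u v lambda mu : C) : (nat -> C) -> Prop :=
  three_term (s_main sch u v lambda) (shifted u) (shifted v) mu.

Definition scheme_solution (u v lambda mu : C) : nat -> C :=
  minimal mu (s_rho sch v) (s_alpha sch u v lambda) (s_beta sch u v mu).

Definition converges_near_0 (a : nat -> C) : Prop :=
  exists r : R, (0 < r)%R /\ forall z : C, (0 < Cmod z < r)%R ->
    exists s, is_series (V := C_NormedModule) (fun j => a j * z ^ j) s.

Section AtParameters.
Variables (u v lambda mu : C).
Hypothesis mu_neq_0 : mu <> 0.
Hypothesis uv_nonvanishing : nonvanishing u v.

(** Fixed parameters are regarded as constant functions near 0 in C, so the estimates with
    parameters also yield the pointwise statements. *)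
Lemma scheme_tame_const : exists r K,
  tame (U := C_NormedModule) (RtoC 0) r K (fun _ => mu) (fun _ => s_rho sch v)
    (fun _ => s_alpha sch u v lambda) (fun _ => s_beta sch u v mu).
Proof.
set (K := (Cmod u + Cmod v + Cmod lambda + Cmod mu)%R).
generalize (Cmod_ge_0 u) (Cmod_ge_0 v) (Cmod_ge_0 lambda) (Cmod_ge_0 mu). intros.
destruct (s_tame sch C_NormedModule (RtoC 0) 1 K (fun _ => u) (fun _ => v) (fun _ => lambda)
  (fun _ => mu)) as (r & K' & _ & T); try exact uv_nonvanishing; try lra;
  try (eapply jet_weaken; [apply Rle_refl | | apply jet_const]; unfold K; lra).
now exists r, K'.
Qed.

Lemma scheme_solution_recurrence :
  scheme_recurrence u v lambda mu (scheme_solution u v lambda mu).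
Proof.
destruct scheme_tame_const as (r & K & T).
apply (minimal_three_term _ r K _ _ _ _ _ _ _ T).
- intro i. now apply s_alpha_eq.
- intro i. now apply s_beta_eq.
Qed.

Lemma scheme_solution_neq_0 : exists j, scheme_solution u v lambda mu j <> 0.
Proof.
destruct scheme_tame_const as (r & K & T).
apply (minimal_neq_0 _ r K _ _ _ _ T mu_neq_0).
intro i. now apply (s_rho_neq_0 sch u v).
Qed.

Lemma scheme_solution_summable z :
  ex_series (fun j => Cmod (scheme_solution u v lambda mu j * z ^ j)).
Proof.
destruct scheme_tame_const as (r & K & T). exact (minimal_summable _ r K _ _ _ _ T z).
Qed.

Lemma scheme_solution_series z :
  is_series (V := C_NormedModule) (fun j => scheme_solution u v lambda mu j * z ^ j)
    (Csum (fun j => scheme_solution u v lambda mu j * z ^ j)).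
Proof. apply Csum_correct, scheme_solution_summable. Qed.

Lemma scheme_solution_unique a : scheme_recurrence u v lambda mu a -> converges_near_0 a ->
  exists c, forall j, a j = c * scheme_solution u v lambda mu j.
Proof.
intros Ha (r & Hr & Hc).
destruct (shifted_ratio u v (fun i => proj1 (uv_nonvanishing i))) as (Q & HQ & HAB).
apply (three_term_unique (s_main sch u v lambda) (shifted u) (shifted v) mu) with Q; auto.
- intro i; apply uv_nonvanishing.
- intro i; apply uv_nonvanishing.
- apply scheme_solution_recurrence.
- apply scheme_solution_neq_0.
- intros R HR. destruct (is_series_terms_bounded _ _ (scheme_solution_series (RtoC R))) as [M HM].
  exists M. intro j. rewrite <- (Rabs_pos_eq R) by lra. rewrite <- Cmod_R, <- Cmod_pow, <- Cmod_mult.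
  apply HM.
- destruct (Hc (RtoC (r / 2))) as [s Hs].
  { rewrite Cmod_R, Rabs_pos_eq; lra. }
  destruct (is_series_terms_bounded _ _ Hs) as [M HM].
  exists (r / 2)%R, M. split; [lra|]. intro j.
  rewrite <- (Rabs_pos_eq (r / 2)) by lra. rewrite <- Cmod_R, <- Cmod_pow, <- Cmod_mult.
  apply HM.
Qed.

(** By uniqueness, a solution that converges near 0 is a multiple of the entire one. *)
Lemma scheme_converges a : scheme_recurrence u v lambda mu a -> converges_near_0 a ->
  forall z, exists s, is_series (V := C_NormedModule) (fun j => a j * z ^ j) s.
Proof.
intros Ha Hc z. destruct (scheme_solution_unique a Ha Hc) as [c Hc'].
exists (c * Csum (fun j => scheme_solution u v lambda mu j * z ^ j)).
eapply is_series_ext; [|exact (is_series_scal (V := C_NormedModule) c _ _ (scheme_solution_series z))].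
intro j. simpl. rewrite Hc'. apply Cmult_assoc.
Qed.
End AtParameters.

Section Holomorphy.
Context {U : NormedModule C_AbsRing}.
Variables (p : U) (r K : R) (u v lambda mu : U -> C).
Hypothesis r_range : (0 < r <= 1)%R.
Hypothesis u_jet : jet p r K u.
Hypothesis v_jet : jet p r K v.
Hypothesis lambda_jet : jet p r K lambda.
Hypothesis mu_jet : jet p r K mu.
Hypothesis uv_nonvanishing : nonvanishing (u p) (v p).

Lemma scheme_solution_differentiable j :
  ex_filterdiff (K := C_AbsRing) (U := U) (V := C_NormedModule)
    (fun q => scheme_solution (u q) (v q) (lambda q) (mu q) j) (locally p).
Proof.
destruct (s_tame sch U p r K u v lambda mu) as (r' & K' & Hr & T); auto.
eapply jet_differentiable; [|exact (jet_minimal _ _ _ _ _ _ _ T j)]. apply Hr.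
Qed.

Lemma scheme_sum_jet zeta : jet p r K zeta -> exists r' M, (0 < r' <= r)%R /\
  jet p r' M (fun q =>
    Csum (fun j => scheme_solution (u q) (v q) (lambda q) (mu q) j * zeta q ^ j)).
Proof.
intro Hz.
destruct (s_tame sch U p r K u v lambda mu) as (r' & K' & Hr & T); auto.
destruct (jet_minimal_sum _ _ _ _ _ _ _ T K zeta) as [M HM].
- apply jet_weaken with r K; auto; lra.
- now exists r', M.
Qed.
End Holomorphy.
End SchemeSolutions.

(** * Integer powers and their dependence on the base *)

Lemma Cpowz_succ (z : C) k : z <> 0 -> Cpowz z (k + 1) = Cpowz z k * z.
Proof.
intro Hz.
assert (P : forall p, Cpowz z (Zpos p) = z ^ Pos.to_nat p) by reflexivity.
assert (N : forall n, Cpowz z (Z.of_nat n) = z ^ n).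
{ intros [|n]; [reflexivity|]. simpl Z.of_nat. rewrite P, SuccNat2Pos.id_succ. reflexivity. }
assert (M : forall n, Cpowz z (- Z.of_nat n) = / z ^ n).
{ intros [|n]; [simpl; field|]. simpl Z.of_nat. simpl Z.opp. unfold Cpowz.
  rewrite SuccNat2Pos.id_succ. reflexivity. }
destruct (Z_le_gt_dec 0 k) as [Hk|Hk].
- rewrite <- (Z2Nat.id k Hk). replace (Z.of_nat (Z.to_nat k) + 1)%Z with (Z.of_nat (S (Z.to_nat k))) by lia.
  rewrite !N. simpl. ring.
- replace k with (- Z.of_nat (S (Z.to_nat (- k - 1))))%Z by lia.
  replace (- Z.of_nat (S (Z.to_nat (- k - 1))) + 1)%Z with (- Z.of_nat (Z.to_nat (- k - 1)))%Z by lia.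
  rewrite !M. simpl. field. split; [apply Cpow_nz | ]; exact Hz.
Qed.

Lemma Cpowz_plus_nat (z : C) k j : z <> 0 -> Cpowz z (k + Z.of_nat j) = Cpowz z k * z ^ j.
Proof.
intro Hz. induction j as [|j IH].
- rewrite Z.add_0_r. simpl. ring.
- rewrite Nat2Z.inj_succ. replace (k + Z.succ (Z.of_nat j))%Z with (k + Z.of_nat j + 1)%Z by lia.
  rewrite Cpowz_succ, IH by exact Hz. simpl. ring.
Qed.

(** Turns a lower series in z into a monomial times a power series in 1/z. *)
Lemma Cpowz_minus_nat (z : C) k j : z <> 0 -> Cpowz z (k - Z.of_nat j) = Cpowz z k * (/ z) ^ j.
Proof.
intro Hz. rewrite <- (Z.sub_add (Z.of_nat j) k) at 2. rewrite Cpowz_plus_nat by exact Hz.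
rewrite <- Cmult_assoc, <- Cpow_mult_l, Cinv_r, Cpow_1_l by exact Hz. ring.
Qed.

Lemma Cpowz_neq_0 (z : C) k : z <> 0 -> Cpowz z k <> 0.
Proof.
intros Hz E. apply C1_nz. destruct k as [|q|q]; simpl in E.
- exact E.
- destruct (Cpow_nz z (Pos.to_nat q) Hz E).
- destruct (inv_neq_0 _ (Cpow_nz z (Pos.to_nat q) Hz) E).
Qed.

Lemma jet_inv_coordinate {U : NormedModule C_AbsRing} (p : U) r K (z : U -> C) :
  (0 < r <= 1)%R -> jet p r K z -> z p <> 0 ->
  exists r' K', (0 < r' <= r)%R /\ jet p r' K' (fun q => / z q).
Proof.
intros Hr Hz Hnz. generalize (jet_pos _ _ _ _ Hz); intro HK.
assert (Hd : (0 < Cmod (z p))%R) by now apply Cmod_gt_0.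
set (d := Cmod (z p)) in *.
assert (He : (0 < d / (2 * K + 1))%R) by (apply Rdiv_lt_0_compat; lra).
exists (Rmin r (d / (2 * K + 1))). eexists. split.
{ split; [apply Rmin_glb_lt; lra | apply Rmin_l]. }
apply jet_ext with (fun q => / (0 + z q)); [intro q; f_equal; ring|].
apply (jet_inv 0 p _ K d z); auto.
- generalize (Rmin_l r (d / (2 * K + 1))). lra.
- apply Rle_trans with ((2 * K + 1) * (d / (2 * K + 1)))%R; [|right; field; lra].
  rewrite <- Rmult_assoc. apply Rmult_le_compat; try lra; [|apply Rmin_r].
  apply Rmin_glb; lra.
- unfold d. right. f_equal. ring.
- apply jet_weaken with r K; [apply Rmin_l | lra | exact Hz].
Qed.

Lemma jet_Cpowz {U : NormedModule C_AbsRing} (p : U) r K (z : U -> C) k :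
  (0 < r <= 1)%R -> jet p r K z -> z p <> 0 ->
  exists r' K', (0 < r' <= r)%R /\ jet p r' K' (fun q => Cpowz (z q) k).
Proof.
intros Hr Hz Hnz. destruct k as [|q|q]; unfold Cpowz.
- exists r, 1%R. split; [lra | apply jet_1].
- exists r. eexists. split; [lra|]. apply jet_pow; [lra | exact Hz].
- apply (jet_inv_coordinate p r (K ^ Pos.to_nat q)); auto.
  + apply jet_pow; [lra | exact Hz].
  + now apply Cpow_nz.
Qed.

(** * Transfer to two-sided indices *)

(* Reversing the direction of summation exchanges the two outer coefficients
   of the recurrence, up to sign. *)
Definition upper_u (k0 : Z) (n b : C) : C := ZtoC k0 + b + n - 1.
Definition upper_v (k0 : Z) (b : C) : C := ZtoC k0 + b + 1.
Definition lower_u (k0 : Z) (b : C) : C := - ZtoC k0 - b - 1.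
Definition lower_v (k0 : Z) (n b : C) : C := - ZtoC k0 - b - n + 1.

Lemma ZtoC_plus_S k0 i : ZtoC (k0 + Z.of_nat (S i)) = ZtoC k0 + RtoC (INR i + 1).
Proof. unfold ZtoC. rewrite plus_IZR, <- INR_IZR_INZ, S_INR, <- RtoC_plus. reflexivity. Qed.

Lemma ZtoC_minus_S k0 i : ZtoC (k0 - Z.of_nat (S i)) = ZtoC k0 - RtoC (INR i + 1).
Proof. unfold ZtoC. rewrite minus_IZR, <- INR_IZR_INZ, S_INR, <- RtoC_minus. reflexivity. Qed.

Lemma upper_shifted_u k0 n b i :
  shifted (upper_u k0 n b) i = ZtoC (k0 + Z.of_nat (S i)) + b + n - 1.
Proof. rewrite ZtoC_plus_S. unfold shifted, upper_u. ring. Qed.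

Lemma upper_shifted_v k0 b i :
  shifted (upper_v k0 b) i = ZtoC (k0 + Z.of_nat (S i)) + b + 1.
Proof. rewrite ZtoC_plus_S. unfold shifted, upper_v. ring. Qed.

Lemma lower_shifted_u k0 b i :
  shifted (lower_u k0 b) i = - (ZtoC (k0 - Z.of_nat (S i)) + b + 1).
Proof. rewrite ZtoC_minus_S. unfold shifted, lower_u. ring. Qed.

Lemma lower_shifted_v k0 n b i :
  shifted (lower_v k0 n b) i = - (ZtoC (k0 - Z.of_nat (S i)) + b + n - 1).
Proof. rewrite ZtoC_minus_S. unfold shifted, lower_v. ring. Qed.

Lemma upper_nonvanishing k0 n b :
  nonresonant_above k0 n b -> nonvanishing (upper_u k0 n b) (upper_v k0 b).
Proof. intros H i. rewrite upper_shifted_u, upper_shifted_v. apply H. lia. Qed.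

Lemma Copp_neq_0 (z : C) : z <> 0 -> - z <> 0.
Proof. intros Hz E. apply Hz. replace z with (- - z) by ring. rewrite E. ring. Qed.

Lemma lower_nonvanishing k0 n b :
  nonresonant_below k0 n b -> nonvanishing (lower_u k0 b) (lower_v k0 n b).
Proof.
intros H i. rewrite lower_shifted_u, lower_shifted_v.
destruct (H (k0 - Z.of_nat (S i))%Z ltac:(lia)). split; now apply Copp_neq_0.
Qed.

Lemma upper_recurrence k0 n lambda mu b a :
  (forall k, (k0 < k)%Z -> recurrence n lambda mu b a k) <->
  scheme_recurrence upper_scheme (upper_u k0 n b) (upper_v k0 b) lambda mu
    (fun j => a (k0 + Z.of_nat j)%Z).
Proof.
assert (X : forall i,
  s_main upper_scheme (upper_u k0 n b) (upper_v k0 b) lambda i * a (k0 + Z.of_nat (S i))%Z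
  - mu * shifted (upper_u k0 n b) i * a (k0 + Z.of_nat i)%Z
  + mu * shifted (upper_v k0 b) i * a (k0 + Z.of_nat (S (S i)))%Z = 0 <->
  recurrence n lambda mu b a (k0 + Z.of_nat (S i))).
{ intro i. simpl s_main. unfold upper_main, recurrence.
  rewrite upper_shifted_u, upper_shifted_v.
  replace (k0 + Z.of_nat (S i) - 1)%Z with (k0 + Z.of_nat i)%Z by lia.
  replace (k0 + Z.of_nat (S i) + 1)%Z with (k0 + Z.of_nat (S (S i)))%Z by lia.
  set (w := ZtoC (k0 + Z.of_nat (S i))).
  replace ((w + b + 1 - 1) * (w + b + n - 1) + lambda)
    with ((w + b) * (w + b + n - 1) + lambda) by ring.
  reflexivity. }
split.
- intros H i. apply X, H. lia.
- intros H k Hk. replace k with (k0 + Z.of_nat (S (Z.to_nat (k - k0 - 1))))%Z by lia.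
  apply X, H.
Qed.

Lemma lower_recurrence k0 n lambda mu b a :
  (forall k, (k < k0)%Z -> recurrence n lambda mu b a k) <->
  scheme_recurrence lower_scheme (lower_u k0 b) (lower_v k0 n b) lambda mu
    (fun j => a (k0 - Z.of_nat j)%Z).
Proof.
assert (X : forall i,
  s_main lower_scheme (lower_u k0 b) (lower_v k0 n b) lambda i * a (k0 - Z.of_nat (S i))%Z
  - mu * shifted (lower_u k0 b) i * a (k0 - Z.of_nat i)%Z
  + mu * shifted (lower_v k0 n b) i * a (k0 - Z.of_nat (S (S i)))%Z = 0 <->
  recurrence n lambda mu b a (k0 - Z.of_nat (S i))).
{ intro i. simpl s_main. unfold lower_main, recurrence.
  rewrite lower_shifted_u, lower_shifted_v.
  replace (k0 - Z.of_nat (S i) - 1)%Z with (k0 - Z.of_nat (S (S i)))%Z by lia.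
  replace (k0 - Z.of_nat (S i) + 1)%Z with (k0 - Z.of_nat i)%Z by lia.
  set (w := ZtoC (k0 - Z.of_nat (S i))).
  match goal with |- iff (?l = _) (?r = _) => replace l with r by ring end.
  reflexivity. }
split.
- intros H i. apply X, H. lia.
- intros H k Hk. replace k with (k0 - Z.of_nat (S (Z.to_nat (k0 - k - 1))))%Z by lia.
  apply X, H.
Qed.

Lemma is_series_factor (f g : nat -> C) (c s : C) : (forall j, g j = c * f j) ->
  is_series (V := C_NormedModule) f s -> is_series (V := C_NormedModule) g (c * s).
Proof.
intros E H. eapply is_series_ext; [|exact (is_series_scal (V := C_NormedModule) c _ _ H)].
intro j. symmetry. apply E.
Qed.

Lemma upper_sum_of_series k0 a (z s : C) : z <> 0 ->
  is_series (V := C_NormedModule) (fun j => a (k0 + Z.of_nat j)%Z * z ^ j) s ->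
  upper_sum k0 a z (Cpowz z k0 * s).
Proof.
intro Hz. apply is_series_factor. intro j. cbv zeta. rewrite Cpowz_plus_nat by exact Hz. ring.
Qed.

Lemma lower_sum_of_series k0 a (z s : C) : z <> 0 ->
  is_series (V := C_NormedModule) (fun j => a (k0 - Z.of_nat j)%Z * (/ z) ^ j) s ->
  lower_sum k0 a z (Cpowz z k0 * s).
Proof.
intro Hz. apply is_series_factor. intro j. cbv zeta. rewrite Cpowz_minus_nat by exact Hz. ring.
Qed.

Lemma series_of_upper_sum k0 a (z s : C) : z <> 0 -> upper_sum k0 a z s ->
  is_series (V := C_NormedModule) (fun j => a (k0 + Z.of_nat j)%Z * z ^ j) (/ Cpowz z k0 * s).
Proof.
intro Hz. apply is_series_factor. intro j. cbv zeta. rewrite Cpowz_plus_nat by exact Hz.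
field. now apply Cpowz_neq_0.
Qed.

Lemma series_of_lower_sum k0 a (z s : C) : z <> 0 -> lower_sum k0 a z s ->
  is_series (V := C_NormedModule) (fun j => a (k0 - Z.of_nat j)%Z * (/ z) ^ j) (/ Cpowz z k0 * s).
Proof.
intro Hz. apply is_series_factor. intro j. cbv zeta. rewrite Cpowz_minus_nat by exact Hz.
generalize (/ z). intro t. field. now apply Cpowz_neq_0.
Qed.

Lemma upper_converges_near_0 k0 a :
  (exists r : R, (0 < r)%R /\ forall z : C, (0 < Cmod z < r)%R -> upper_converges k0 a z) ->
  converges_near_0 (fun j => a (k0 + Z.of_nat j)%Z).
Proof.
intros (r & Hr & H). exists r. split; [exact Hr|]. intros z Hz.
destruct (H z Hz) as [s Hs]. eexists. apply (series_of_upper_sum _ _ _ s); [|exact Hs].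
apply Cmod_gt_0, Hz.
Qed.

(** Inversion maps the exterior of the disk of radius r to the punctured disk of radius 1/r. *)
Lemma lower_converges_near_0 k0 a :
  (exists r : R, (0 < r)%R /\ forall z : C, (r < Cmod z)%R -> lower_converges k0 a z) ->
  converges_near_0 (fun j => a (k0 - Z.of_nat j)%Z).
Proof.
intros (r & Hr & H). exists (/ r)%R. split; [now apply Rinv_0_lt_compat|]. intros z Hz.
assert (Hz0 : z <> 0) by apply Cmod_gt_0, Hz.
assert (Hi : (r < Cmod (/ z))%R).
{ rewrite Cmod_inv by exact Hz0. rewrite <- (Rinv_inv r).
  apply Rinv_0_lt_contravar; apply Hz. }
destruct (H (/ z) Hi) as [s Hs]. exists (/ Cpowz (/ z) k0 * s).
eapply is_series_ext; [|apply (series_of_lower_sum k0 a (/ z) s); [now apply inv_neq_0 | exact Hs]].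
intro j. replace (/ / z) with z by (field; exact Hz0). reflexivity.
Qed.

(** * The two one-sided series at fixed parameters *)

(** [Z.to_nat] truncates at 0, so the default value for [k < k0] is the coefficient at [k0]. *)
Definition upper_coefs (k0 : Z) (n lambda mu b : C) (k : Z) : C :=
  scheme_solution upper_scheme (upper_u k0 n b) (upper_v k0 b) lambda mu (Z.to_nat (k - k0)).

Definition lower_coefs (k0 : Z) (n lambda mu b : C) (k : Z) : C :=
  scheme_solution lower_scheme (lower_u k0 b) (lower_v k0 n b) lambda mu (Z.to_nat (k0 - k)).

Lemma upper_coefs_nat k0 n lambda mu b j : upper_coefs k0 n lambda mu b (k0 + Z.of_nat j)
  = scheme_solution upper_scheme (upper_u k0 n b) (upper_v k0 b) lambda mu j.
Proof. unfold upper_coefs. f_equal. lia. Qed.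

Lemma lower_coefs_nat k0 n lambda mu b j : lower_coefs k0 n lambda mu b (k0 - Z.of_nat j)
  = scheme_solution lower_scheme (lower_u k0 b) (lower_v k0 n b) lambda mu j.
Proof. unfold lower_coefs. f_equal. lia. Qed.

Lemma three_term_ext E A B mu a a' : (forall j, a j = a' j) ->
  three_term E A B mu a -> three_term E A B mu a'.
Proof. intros X H i. rewrite <- !X. apply H. Qed.

Section FixedParameters.
Variables (k0 : Z) (n lambda mu b : C).
Hypothesis mu_neq_0 : mu <> 0.

Lemma upper_coefs_sum (z : C) : nonresonant_above k0 n b -> z <> 0 ->
  upper_sum k0 (upper_coefs k0 n lambda mu b) z (Cpowz z k0 * Csum (fun j =>
    scheme_solution upper_scheme (upper_u k0 n b) (upper_v k0 b) lambda mu j * z ^ j)).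
Proof.
intros Hr Hz. apply upper_sum_of_series; [exact Hz|].
eapply is_series_ext; [|apply scheme_solution_series; auto using upper_nonvanishing].
intro j. now rewrite upper_coefs_nat.
Qed.

Lemma lower_coefs_sum (z : C) : nonresonant_below k0 n b -> z <> 0 ->
  lower_sum k0 (lower_coefs k0 n lambda mu b) z (Cpowz z k0 * Csum (fun j =>
    scheme_solution lower_scheme (lower_u k0 b) (lower_v k0 n b) lambda mu j * (/ z) ^ j)).
Proof.
intros Hr Hz. apply lower_sum_of_series; [exact Hz|].
eapply is_series_ext; [|apply scheme_solution_series; auto using lower_nonvanishing].
intro j. now rewrite lower_coefs_nat.
Qed.

Lemma upper_coefs_solution : nonresonant_above k0 n b ->
  upper_solution k0 n lambda mu b (upper_coefs k0 n lambda mu b).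
Proof.
intro Hr. assert (Hnv := upper_nonvanishing k0 n b Hr). split; [|split].
- destruct (scheme_solution_neq_0 upper_scheme _ _ lambda mu mu_neq_0 Hnv) as [j Hj].
  exists (k0 + Z.of_nat j)%Z. split; [lia|]. now rewrite upper_coefs_nat.
- apply upper_recurrence. eapply three_term_ext; [intro j; symmetry; apply upper_coefs_nat|].
  now apply scheme_solution_recurrence.
(* The radius 1 is arbitrary: the series converges at every nonzero point. *)
- exists 1%R. split; [lra|]. intros z Hz. eexists. apply upper_coefs_sum; [exact Hr|].
  apply Cmod_gt_0, Hz.
Qed.

Lemma lower_coefs_solution : nonresonant_below k0 n b ->
  lower_solution k0 n lambda mu b (lower_coefs k0 n lambda mu b).
Proof.
intro Hr. assert (Hnv := lower_nonvanishing k0 n b Hr). split; [|split].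
- destruct (scheme_solution_neq_0 lower_scheme _ _ lambda mu mu_neq_0 Hnv) as [j Hj].
  exists (k0 - Z.of_nat j)%Z. split; [lia|]. now rewrite lower_coefs_nat.
- apply lower_recurrence. eapply three_term_ext; [intro j; symmetry; apply lower_coefs_nat|].
  now apply scheme_solution_recurrence.
- exists 1%R. split; [lra|]. intros z Hz. eexists. apply lower_coefs_sum; [exact Hr|].
  apply Cmod_gt_0. lra.
Qed.

Lemma upper_solution_unique a : nonresonant_above k0 n b -> upper_solution k0 n lambda mu b a ->
  exists c, forall k, (k0 <= k)%Z -> a k = c * upper_coefs k0 n lambda mu b k.
Proof.
intros Hr (_ & Hrec & Hconv).
destruct (scheme_solution_unique upper_scheme _ _ lambda mu mu_neq_0 (upper_nonvanishing k0 n b Hr)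
  (fun j => a (k0 + Z.of_nat j)%Z)) as [c Hc].
- now apply upper_recurrence.
- now apply upper_converges_near_0.
- exists c. intros k Hk. unfold upper_coefs. rewrite <- Hc. f_equal. lia.
Qed.

Lemma lower_solution_unique a : nonresonant_below k0 n b -> lower_solution k0 n lambda mu b a ->
  exists c, forall k, (k <= k0)%Z -> a k = c * lower_coefs k0 n lambda mu b k.
Proof.
intros Hr (_ & Hrec & Hconv).
destruct (scheme_solution_unique lower_scheme _ _ lambda mu mu_neq_0 (lower_nonvanishing k0 n b Hr)
  (fun j => a (k0 - Z.of_nat j)%Z)) as [c Hc].
- now apply lower_recurrence.
- now apply lower_converges_near_0.
- exists c. intros k Hk. unfold lower_coefs. rewrite <- Hc. f_equal. lia.
Qed.

Lemma upper_solution_converges a (z : C) : nonresonant_above k0 n b ->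
  upper_solution k0 n lambda mu b a -> z <> 0 -> upper_converges k0 a z.
Proof.
intros Hr (_ & Hrec & Hconv) Hz.
destruct (scheme_converges upper_scheme _ _ lambda mu mu_neq_0 (upper_nonvanishing k0 n b Hr)
  (fun j => a (k0 + Z.of_nat j)%Z)) with z as [s Hs].
- now apply upper_recurrence.
- now apply upper_converges_near_0.
- eexists. apply upper_sum_of_series; eassumption.
Qed.

Lemma lower_solution_converges a (z : C) : nonresonant_below k0 n b ->
  lower_solution k0 n lambda mu b a -> z <> 0 -> lower_converges k0 a z.
Proof.
intros Hr (_ & Hrec & Hconv) Hz.
destruct (scheme_converges lower_scheme _ _ lambda mu mu_neq_0 (lower_nonvanishing k0 n b Hr)
  (fun j => a (k0 - Z.of_nat j)%Z)) with (/ z) as [s Hs].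
- now apply lower_recurrence.
- now apply lower_converges_near_0.
- eexists. apply lower_sum_of_series; eassumption.
Qed.
End FixedParameters.

(** * Holomorphic dependence on the parameters *)

(** Coordinates are abstracted to functionals of norm at most 1, so that the same lemmas apply on
    [C4] and, after composition with [snd], on [C1_4]. *)
Definition bounded_linear {U : NormedModule C_AbsRing} (L : U -> C) : Prop :=
  Clinear L /\ forall h, (Cmod (L h) <= norm h)%R.

Section Coordinates.
Context {U : NormedModule C_AbsRing}.
Variables (n lambda mu b : U -> C).
Hypothesis n_lin : bounded_linear n.
Hypothesis lambda_lin : bounded_linear lambda.
Hypothesis mu_lin : bounded_linear mu.
Hypothesis b_lin : bounded_linear b.

Lemma jet_bounded_linear (p : U) L : bounded_linear L -> jet p 1 (Cmod (L p) + 1) L.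
Proof. intros []. now apply jet_Clinear. Qed.

Lemma jet_Copp (p : U) r M f : (r <= 1)%R -> jet p r M f -> jet p r M (fun q => - f q).
Proof.
intros Hr Hf. apply jet_ext with (fun q => (- (1)) * f q); [intro q; ring|].
apply jet_weaken with r (Cmod (- (1)) * M)%R; [lra | |].
- rewrite Cmod_opp, Cmod_1. lra.
- apply jet_mult; [exact Hr | apply jet_const | exact Hf].
Qed.

Lemma coordinate_jets (p : U) k0 : exists K,
  jet p 1 K (fun q => upper_u k0 (n q) (b q)) /\ jet p 1 K (fun q => upper_v k0 (b q)) /\
  jet p 1 K (fun q => lower_u k0 (b q)) /\ jet p 1 K (fun q => lower_v k0 (n q) (b q)) /\
  jet p 1 K lambda /\ jet p 1 K mu.
Proof.
generalize (jet_bounded_linear p n n_lin) (jet_bounded_linear p b b_lin)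
  (jet_bounded_linear p lambda lambda_lin) (jet_bounded_linear p mu mu_lin).
generalize (Cmod_ge_0 (n p)) (Cmod_ge_0 (b p)) (Cmod_ge_0 (lambda p)) (Cmod_ge_0 (mu p)).
generalize (Cmod_ge_0 (ZtoC k0)). intros ? ? ? ? ? Jn Jb Jl Jm.
exists (Cmod (ZtoC k0) + (Cmod (b p) + 1) + (Cmod (n p) + 1) + Cmod 1
  + Cmod (lambda p) + Cmod (mu p))%R.
assert (C1 : Cmod 1 = 1%R) by apply Cmod_1.
assert (Cm1 : Cmod (- (1)) = 1%R) by (rewrite Cmod_opp; exact C1).
assert (J1 := jet_plus _ _ _ _ _ _ (jet_const p 1 (ZtoC k0)) Jb).
assert (J2 := jet_plus _ _ _ _ _ _ J1 Jn).
assert (J1' := jet_plus _ _ _ _ _ _ J1 (jet_const p 1 1)).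
assert (J2' := jet_plus _ _ _ _ _ _ J2 (jet_const p 1 (- (1)))).
assert (J3 := jet_Copp _ _ _ _ (Rle_refl 1) J1').
assert (J4 := jet_Copp _ _ _ _ (Rle_refl 1) J2').
cbv beta in *. rewrite ?C1, ?Cm1 in *.
repeat split.
- refine (jet_weaken _ _ _ _ _ _ (Rle_refl 1) _ J2'). lra.
- refine (jet_weaken _ _ _ _ _ _ (Rle_refl 1) _ J1'). lra.
- refine (jet_weaken _ _ _ _ _ _ (Rle_refl 1) _ (jet_ext _ _ _ _ _ _ J3)); [lra|].
  intro q. unfold lower_u. ring.
- refine (jet_weaken _ _ _ _ _ _ (Rle_refl 1) _ (jet_ext _ _ _ _ _ _ J4)); [lra|].
  intro q. unfold lower_v. ring.
- refine (jet_weaken _ _ _ _ _ _ (Rle_refl 1) _ Jl). lra.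
- refine (jet_weaken _ _ _ _ _ _ (Rle_refl 1) _ Jm). lra.
Qed.

Lemma upper_coefs_differentiable (p : U) k0 k : nonresonant_above k0 (n p) (b p) ->
  ex_filterdiff (K := C_AbsRing) (U := U) (V := C_NormedModule)
    (fun q => upper_coefs k0 (n q) (lambda q) (mu q) (b q) k) (locally p).
Proof.
intro H. destruct (coordinate_jets p k0) as (K & Ju & Jv & _ & _ & Jl & Jm).
unfold upper_coefs.
apply (scheme_solution_differentiable upper_scheme p 1 K
  (fun q => upper_u k0 (n q) (b q)) (fun q => upper_v k0 (b q))); auto; [lra|].
now apply upper_nonvanishing.
Qed.

Lemma lower_coefs_differentiable (p : U) k0 k : nonresonant_below k0 (n p) (b p) ->
  ex_filterdiff (K := C_AbsRing) (U := U) (V := C_NormedModule)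
    (fun q => lower_coefs k0 (n q) (lambda q) (mu q) (b q) k) (locally p).
Proof.
intro H. destruct (coordinate_jets p k0) as (K & _ & _ & Ju & Jv & Jl & Jm).
unfold lower_coefs.
apply (scheme_solution_differentiable lower_scheme p 1 K
  (fun q => lower_u k0 (b q)) (fun q => lower_v k0 (n q) (b q))); auto; [lra|].
now apply lower_nonvanishing.
Qed.

(** The base [z] of the monomial and the argument [zeta] of the power series are separate because
    [zeta] is [z] for the upper series and [/ z] for the lower one. *)
Lemma scheme_sum_differentiable sch (p : U) K k0 (u v z zeta : U -> C) r :
  (0 < r <= 1)%R -> jet p r K u -> jet p r K v -> jet p r K lambda -> jet p r K mu ->
  nonvanishing (u p) (v p) -> jet p r K z -> z p <> 0 -> jet p r K zeta ->
  ex_filterdiff (K := C_AbsRing) (U := U) (V := C_NormedModule)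
    (fun q => Cpowz (z q) k0 * Csum (fun j =>
      scheme_solution sch (u q) (v q) (lambda q) (mu q) j * zeta q ^ j)) (locally p).
Proof.
intros Hr Ju Jv Jl Jm Hnv Jz Hz Jzeta.
destruct (scheme_sum_jet sch p r K u v lambda mu Hr Ju Jv Jl Jm Hnv zeta Jzeta)
  as (r1 & M1 & Hr1 & J1).
destruct (jet_Cpowz p r K z k0 Hr Jz Hz) as (r2 & M2 & Hr2 & J2).
apply (jet_differentiable p (Rmin r1 r2) (M2 * M1)); [apply Rmin_glb_lt; lra|].
generalize (Rmin_l r1 r2) (Rmin_r r1 r2). intros.
apply jet_mult; [lra | |].
- apply jet_weaken with r2 M2; auto; lra.
- apply jet_weaken with r1 M1; auto; lra.
Qed.

Lemma upper_sum_differentiable (p : U) k0 z : bounded_linear z -> z p <> 0 ->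
  nonresonant_above k0 (n p) (b p) ->
  ex_filterdiff (K := C_AbsRing) (U := U) (V := C_NormedModule)
    (fun q => Cpowz (z q) k0 * Csum (fun j =>
      scheme_solution upper_scheme (upper_u k0 (n q) (b q)) (upper_v k0 (b q))
        (lambda q) (mu q) j * z q ^ j)) (locally p).
Proof.
intros Hz Hz0 H. destruct (coordinate_jets p k0) as (K & Ju & Jv & _ & _ & Jl & Jm).
generalize (jet_bounded_linear p z Hz) (jet_pos _ _ _ _ Ju) (Cmod_ge_0 (z p)). intros Jz HK Hzp.
apply (scheme_sum_differentiable upper_scheme p (K + (Cmod (z p) + 1)) k0
  (fun q => upper_u k0 (n q) (b q)) (fun q => upper_v k0 (b q)) z z 1); auto;
  try (eapply jet_weaken; [apply Rle_refl | | eassumption]; lra); [lra|].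
now apply upper_nonvanishing.
Qed.

Lemma lower_sum_differentiable (p : U) k0 z : bounded_linear z -> z p <> 0 ->
  nonresonant_below k0 (n p) (b p) ->
  ex_filterdiff (K := C_AbsRing) (U := U) (V := C_NormedModule)
    (fun q => Cpowz (z q) k0 * Csum (fun j =>
      scheme_solution lower_scheme (lower_u k0 (b q)) (lower_v k0 (n q) (b q))
        (lambda q) (mu q) j * (/ z q) ^ j)) (locally p).
Proof.
intros Hz Hz0 H. destruct (coordinate_jets p k0) as (K & _ & _ & Ju & Jv & Jl & Jm).
generalize (jet_bounded_linear p z Hz) (jet_pos _ _ _ _ Ju) (Cmod_ge_0 (z p)). intros Jz HK Hzp.
(* The expansion of [/ z] holds only on a ball that stays away from z = 0, so the radius shrinks
   from 1 to [r]. *)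
destruct (jet_inv_coordinate p 1 _ z ltac:(lra) Jz Hz0) as (r & K' & Hr & Jzeta).
generalize (jet_pos _ _ _ _ Jzeta). intro HK'.
apply (scheme_sum_differentiable lower_scheme p (K + (Cmod (z p) + 1) + K') k0
  (fun q => lower_u k0 (b q)) (fun q => lower_v k0 (n q) (b q)) z (fun q => / z q) r); auto;
  try (eapply jet_weaken; [| | eassumption]; lra).
now apply lower_nonvanishing.
Qed.
End Coordinates.

(** * Coordinate projections on the parameter spaces *)

Lemma bounded_linear_fst {V : NormedModule C_AbsRing} (L : V -> C) :
  bounded_linear L -> forall W : NormedModule C_AbsRing,
  bounded_linear (U := prod_NormedModule C_AbsRing V W) (fun p => L (fst p)).
Proof.
intros [[Lp Ls] Ln] W. split; [split|].
- intros x y. apply Lp.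
- intros k x. apply Ls.
- intro h. eapply Rle_trans; [apply Ln|]. exact (norm_le_prod_norm_1 (U := V) (V := W) h).
Qed.

Lemma bounded_linear_snd {V : NormedModule C_AbsRing} (L : V -> C) :
  bounded_linear L -> forall W : NormedModule C_AbsRing,
  bounded_linear (U := prod_NormedModule C_AbsRing W V) (fun p => L (snd p)).
Proof.
intros [[Lp Ls] Ln] W. split; [split|].
- intros x y. apply Lp.
- intros k x. apply Ls.
- intro h. eapply Rle_trans; [apply Ln|]. exact (norm_le_prod_norm_2 (U := W) (V := V) h).
Qed.

Lemma bounded_linear_id : bounded_linear (U := C_NormedModule) (fun z : C => z).
Proof. split; [split; intros; reflexivity | intro h; apply Rle_refl]. Qed.

Definition par_n (p : C4) : C := fst (fst (fst p)).
Definition par_lambda (p : C4) : C := snd (fst (fst p)).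
Definition par_mu (p : C4) : C := snd (fst p).
Definition par_b (p : C4) : C := snd p.

Lemma par_n_lin : bounded_linear par_n.
Proof.
exact (bounded_linear_fst _ (bounded_linear_fst _ (bounded_linear_fst _ bounded_linear_id _) _) _).
Qed.

Lemma par_lambda_lin : bounded_linear par_lambda.
Proof.
exact (bounded_linear_fst _ (bounded_linear_fst _ (bounded_linear_snd _ bounded_linear_id _) _) _).
Qed.

Lemma par_mu_lin : bounded_linear par_mu.
Proof. exact (bounded_linear_fst _ (bounded_linear_snd _ bounded_linear_id _) _). Qed.

Lemma par_b_lin : bounded_linear par_b.
Proof. exact (bounded_linear_snd _ bounded_linear_id _). Qed.

Lemma z_lin : bounded_linear (U := C1_4) (fun q => fst q).
Proof. exact (bounded_linear_fst _ bounded_linear_id _). Qed.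

Theorem theorem1p10 :
  (* (i) *)
  (forall (b n : C) (k0 : Z), nonresonant_above k0 n b ->
   forall lambda mu : C, mu <> 0 ->
   exists a : Z -> C,
     upper_solution k0 n lambda mu b a /\
     forall a' : Z -> C, upper_solution k0 n lambda mu b a' ->
       exists c : C, forall k : Z, (k0 <= k)%Z -> a' k = c * a k) /\
  (* (ii) *)
  (forall (b n : C) (k0 : Z), nonresonant_below k0 n b ->
   forall lambda mu : C, mu <> 0 ->
   exists a : Z -> C,
     lower_solution k0 n lambda mu b a /\
     forall a' : Z -> C, lower_solution k0 n lambda mu b a' ->
       exists c : C, forall k : Z, (k <= k0)%Z -> a' k = c * a k) /\
  (* convergence on the whole punctured line *)
  (forall (b n : C) (k0 : Z), nonresonant_above k0 n b ->
   forall lambda mu : C, mu <> 0 ->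
   forall a : Z -> C, upper_solution k0 n lambda mu b a ->
   forall z : C, z <> 0 -> upper_converges k0 a z) /\
  (forall (b n : C) (k0 : Z), nonresonant_below k0 n b ->
   forall lambda mu : C, mu <> 0 ->
   forall a : Z -> C, lower_solution k0 n lambda mu b a ->
   forall z : C, z <> 0 -> lower_converges k0 a z) /\
  (* holomorphic normalizations: both the coefficients, as functions of the
     parameters, and the sum, as a function of z and the parameters *)
  (forall k0 : Z,
   exists (A : C4 -> Z -> C) (F : C1_4 -> C),
     (forall n lambda mu b : C, upper_domain k0 (n, lambda, mu, b) ->
        upper_solution k0 n lambda mu b (A (n, lambda, mu, b))) /\
     (forall k : Z, (k0 <= k)%Z ->
        holomorphic_on (upper_domain k0) (fun p : C4 => A p k)) /\
     (forall (z : C) (p : C4), z <> 0 -> upper_domain k0 p ->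
        upper_sum k0 (A p) z (F (z, p))) /\
     holomorphic_on
       (fun q : C1_4 => (fst q : C) <> 0 /\ upper_domain k0 (snd q)) F) /\
  (forall k0 : Z,
   exists (A : C4 -> Z -> C) (F : C1_4 -> C),
     (forall n lambda mu b : C, lower_domain k0 (n, lambda, mu, b) ->
        lower_solution k0 n lambda mu b (A (n, lambda, mu, b))) /\
     (forall k : Z, (k <= k0)%Z ->
        holomorphic_on (lower_domain k0) (fun p : C4 => A p k)) /\
     (forall (z : C) (p : C4), z <> 0 -> lower_domain k0 p ->
        lower_sum k0 (A p) z (F (z, p))) /\
     holomorphic_on
       (fun q : C1_4 => (fst q : C) <> 0 /\ lower_domain k0 (snd q)) F).
Proof.
split; [|split; [|split; [|split; [|split]]]].
- intros b n k0 Hr lambda mu Hmu. exists (upper_coefs k0 n lambda mu b).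
  split; [now apply upper_coefs_solution|]. intros a' Ha'. now apply upper_solution_unique.
- intros b n k0 Hr lambda mu Hmu. exists (lower_coefs k0 n lambda mu b).
  split; [now apply lower_coefs_solution|]. intros a' Ha'. now apply lower_solution_unique.
- intros b n k0 Hr lambda mu Hmu a Ha z Hz. now apply (upper_solution_converges k0 n lambda mu b).
- intros b n k0 Hr lambda mu Hmu a Ha z Hz. now apply (lower_solution_converges k0 n lambda mu b).
- intro k0.
  exists (fun p => upper_coefs k0 (par_n p) (par_lambda p) (par_mu p) (par_b p)).
  exists (fun q => Cpowz (fst q) k0 * Csum (fun j =>
      scheme_solution upper_scheme (upper_u k0 (par_n (snd q)) (par_b (snd q)))
        (upper_v k0 (par_b (snd q))) (par_lambda (snd q)) (par_mu (snd q)) j * fst q ^ j)).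
  split; [|split; [|split]].
  + intros n lambda mu b [Hmu Hr]. now apply upper_coefs_solution.
  + intros k _ [[[n lambda] mu] b] [_ Hr].
    apply upper_coefs_differentiable;
      [exact par_n_lin | exact par_lambda_lin | exact par_mu_lin | exact par_b_lin | exact Hr].
  + intros z [[[n lambda] mu] b] Hz [Hmu Hr]. now apply upper_coefs_sum.
  + intros [z [[[n lambda] mu] b]] [Hz [_ Hr]].
    apply (upper_sum_differentiable (U := C1_4) (fun q => par_n (snd q))
      (fun q => par_lambda (snd q)) (fun q => par_mu (snd q)) (fun q => par_b (snd q)));
      [exact (bounded_linear_snd _ par_n_lin _) | exact (bounded_linear_snd _ par_lambda_lin _)
      | exact (bounded_linear_snd _ par_mu_lin _) | exact (bounded_linear_snd _ par_b_lin _)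
      | exact z_lin | exact Hz | exact Hr].
- intro k0.
  exists (fun p => lower_coefs k0 (par_n p) (par_lambda p) (par_mu p) (par_b p)).
  exists (fun q => Cpowz (fst q) k0 * Csum (fun j =>
      scheme_solution lower_scheme (lower_u k0 (par_b (snd q)))
        (lower_v k0 (par_n (snd q)) (par_b (snd q))) (par_lambda (snd q)) (par_mu (snd q)) j
      * (/ fst q) ^ j)).
  split; [|split; [|split]].
  + intros n lambda mu b [Hmu Hr]. now apply lower_coefs_solution.
  + intros k _ [[[n lambda] mu] b] [_ Hr].
    apply lower_coefs_differentiable;
      [exact par_n_lin | exact par_lambda_lin | exact par_mu_lin | exact par_b_lin | exact Hr].
  + intros z [[[n lambda] mu] b] Hz [Hmu Hr]. now apply lower_coefs_sum.
  + intros [z [[[n lambda] mu] b]] [Hz [_ Hr]].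
    apply (lower_sum_differentiable (U := C1_4) (fun q => par_n (snd q))
      (fun q => par_lambda (snd q)) (fun q => par_mu (snd q)) (fun q => par_b (snd q)));
      [exact (bounded_linear_snd _ par_n_lin _) | exact (bounded_linear_snd _ par_lambda_lin _)
      | exact (bounded_linear_snd _ par_mu_lin _) | exact (bounded_linear_snd _ par_b_lin _)
      | exact z_lin | exact Hz | exact Hr].
Qed.
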